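(* For $a=(a_1,\ldots,a_m)\in\mathbb{R}^{mn}$ and $b\in\mathbb{R}^m$ let $C(a,b):=\{x\in\mathbb{R}^n\mid\langle a_i,x\rangle\le b_i,\ i=1,\ldots,m\}$, $G(x,a,b):=N(x;C(a,b))$ and $F(x,a,b,u):=N(x;C(a,b))-g(x,u)$, where $g:\mathbb{R}^n\times\mathbb{R}^d\to\mathbb{R}^n$ is $\mathcal{C}^1$-smooth around the reference points, and let $U\subset\mathbb{R}^d$. Let $(x,a,b)\in\mathbb{R}^n\times\mathbb{R}^{mn}\times\mathbb{R}^m$ with $x\in C(a,b)$ be any triple such that the vectors $\{a_i\mid i\in I(x,a,b)\}$ are positively linearly independent, where $I(x,a,b):=\{i\mid\langle a_i,x\rangle=b_i\}$. Let $A$ be the $m\times n$ matrix with rows $a_1,\ldots,a_m$. Then for all $(w,u)\in\mathbb{R}^n\times U$ with $w+g(x,u)\in G(x,a,b)$ we have the coderivative upper estimate $$D^*F(x,a,b,u,w)(y)\subset\bigcup_{\substack{p\in N_{\mathbb{R}^m_-}(Ax-b),\ A^*p=w+g(x,u)\\ q\in D^*N_{\mathbb{R}^m_-}(Ax-b,p)(Ay)}}\begin{pmatrix}A^*q-\nabla_xg(x,u)^*y\\ p_1y+q_1x\\ \vdots\\ p_my+q_mx\\ -q\\ -\nabla_ug(x,u)^*y\end{pmatrix}$$ for every $y\in\bigcap_{\{i\mid p_i>0\}}a_i^\perp$ (with $p$ some vector satisfying $p\in N_{\mathbb{R}^m_-}(Ax-b)$, $A^*p=w+g(x,u)$), where every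 vector $q\in\mathbb{R}^m$ in the union satisfies $$q_i=0\ \text{ for all } i \text{ such that either } \langle a_i,x\rangle<b_i,\ \text{ or } p_i=0 \text{ and } \langle a_i,y\rangle<0,$$ $$q_i\ge0\ \text{ for all } i \text{ such that } \langle a_i,x\rangle=b_i,\ p_i=0 \text{ and } \langle a_i,y\rangle>0.$$ Furthermore, equality holds in the coderivative upper estimate for $D^*F(x,a,b,u,w)(y)$ (that is, $D^*F(x,a,b,u,w)(y)$ is equal to the stated union over $p$ and $q$, and not merely contained in it) if the vectors $\{a_i\mid i\in I(x,a,b)\}$ are linearly independent, in which case the vector $p\in N_{\mathbb{R}^m_-}(Ax-b)$ is uniquely determined by $A^*p=w+g(x,u)$.
   Context: For a nonempty set $\Omega\subset\mathbb{R}^s$ locally closed around $\bar z\in\Omega$, the (limiting) normal cone is $N(\bar z;\Omega)=N_\Omega(\bar z):=\mathop{\mathrm{Lim\,sup}}_{z\to\bar z}\{\mathrm{cone}[z-\Pi(z;\Omega)]\}$, where $\Pi(z;\Omega)$ is the Euclidean projector onto $\Omega$ and $\mathrm{Lim\,sup}$ is the Kuratowski--Painlev\'e outer limit; for convex $\Omega$ it is the normal cone of convex analysis (and it is empty at points outside $\Omega$). For a set-valued mapping $S$ with graph $\mathrm{gph}\,S=\{(x,y)\mid y\in S(x)\}$ locally closed around $(\bar x,\bar y)$, the coderivative is $D^*S(\bar x,\bar y)(u):=\{v\mid(v,-u)\in N((\bar x,\bar y);\mathrm{gph}\,S)\}$. $\mathbb{R}^m_-$ is the nonpositive orthant and $N_{\mathbb{R}^m_-}$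 is viewed as a set-valued mapping $x\mapsto N(x;\mathbb{R}^m_-)$. $^*$ on matrices is transposition, $a_i^\perp$ is the orthogonal complement of $a_i$. Vectors $\{a_i\mid i\in I\}$ are positively linearly independent if $\sum_{i\in I}\alpha_ia_i=0$, $\alpha_i\ge0$, implies $\alpha_i=0$ for all $i\in I$. *)

(* Defs.v *)
From HB Require Import structures.
From mathcomp Require Import all_boot all_order all_algebra.
From mathcomp Require Import all_classical all_reals all_analysis.

Set Implicit Arguments.
Unset Strict Implicit.
Unset Printing Implicit Defensive.

Import Order.TTheory GRing.Theory Num.Theory.
Import numFieldNormedType.Exports.

Local Open Scope classical_set_scope.
Local Open Scope ring_scope.

(** Points of R^s are row vectors ['rV[R]_s].  Hence [A x] is [x *m A^T],
    [A^* p] is [p *m A], and the Jacobian matrix ['J f p] of the library, which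
    acts on rows ([h *m 'J f p]), is the transpose of the usual one: [f'(p)^* y]
    is [y *m ('J f p)^T]. *)

Section VariationalAnalysis.
Variable R : realType.

Definition dot s (u v : 'rV[R]_s) : R := \sum_(i < s) u 0 i * v 0 i.

(* The library norm on matrices is the sup norm. *)
Definition enorm s (u : 'rV[R]_s) : R := Num.sqrt (dot u u).

Definition projector s (Omega : set 'rV[R]_s) (z : 'rV[R]_s) : set 'rV[R]_s :=
  [set w | Omega w /\ forall w', Omega w' -> enorm (z - w) <= enorm (z - w')].

Definition cone s (A : set 'rV[R]_s) : set 'rV[R]_s :=
  [set v | exists t a, [/\ 0 <= t, A a & v = t *: a]].

(* Kuratowski-Painleve outer limit of S at x. *)
Definition outer_limit s t (S : 'rV[R]_s -> set 'rV[R]_t) (x : 'rV[R]_s) :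
    set 'rV[R]_t :=
  [set v | exists (z : nat -> 'rV[R]_s) (w : nat -> 'rV[R]_t),
     [/\ z @ \oo --> x, w @ \oo --> v & forall k, S (z k) (w k)]].

(* Limiting normal cone; empty at points outside Omega. *)
Definition normal_cone s (Omega : set 'rV[R]_s) (zbar : 'rV[R]_s) :
    set 'rV[R]_s :=
  [set v | Omega zbar /\
     outer_limit (fun z => cone [set z - w | w in projector Omega z]) zbar v].

Definition graph s t (S : 'rV[R]_s -> set 'rV[R]_t) : set 'rV[R]_(s + t) :=
  [set z | S (lsubmx z) (rsubmx z)].

Definition coderivative s t (S : 'rV[R]_s -> set 'rV[R]_t)
    (x : 'rV[R]_s) (y : 'rV[R]_t) (u : 'rV[R]_t) : set 'rV[R]_s :=
  [set v | normal_cone (graph S) (row_mx x y) (row_mx v (- u))].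

Definition orthant_nonpos m : set 'rV[R]_m := [set t | forall i, t 0 i <= 0].

(* For a linear map into a finite-dimensional space, continuity of the
   derivative amounts to continuity of each of its directional values. *)
Definition C1_around n d k (g : 'rV[R]_n * 'rV[R]_d -> 'rV[R]_k)
    (z : 'rV[R]_n * 'rV[R]_d) : Prop :=
  \forall z' \near z, differentiable g z' /\
    forall h, {for z', continuous (fun z'' => 'd g z'' h)}.

Definition grad_x n d k (g : 'rV[R]_n * 'rV[R]_d -> 'rV[R]_k)
    (x : 'rV[R]_n) (u : 'rV[R]_d) : 'M[R]_(n, k) := 'J (fun x' => g (x', u)) x.

Definition grad_u n d k (g : 'rV[R]_n * 'rV[R]_d -> 'rV[R]_k)
    (x : 'rV[R]_n) (u : 'rV[R]_d) : 'M[R]_(d, k) := 'J (fun u' => g (x, u')) u.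

End VariationalAnalysis.

Arguments orthant_nonpos {R m}.

Section Polyhedra.
Variables (R : realType) (n m d : nat).
Implicit Types (x : 'rV[R]_n) (A : 'M[R]_(m, n)) (b : 'rV[R]_m) (u : 'rV[R]_d).

(* The family a = (a_1, ..., a_m) is the matrix A with rows a_i. *)
Definition polyhedron A b : set 'rV[R]_n :=
  [set x | forall i, dot (row i A) x <= b 0 i].

Definition active x A b : {set 'I_m} := [set i | dot (row i A) x == b 0 i].

Definition pos_lin_indep (I : {set 'I_m}) A : Prop :=
  forall alpha : 'I_m -> R,
    (forall i, i \in I -> 0 <= alpha i) ->
    \sum_(i in I) alpha i *: row i A = 0 ->
    forall i, i \in I -> alpha i = 0.

Definition G x A b : set 'rV[R]_n := normal_cone (polyhedron A b) x.

Definition F (g : 'rV[R]_n * 'rV[R]_d -> 'rV[R]_n) x A b u : set 'rV[R]_n :=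
  [set v - g (x, u) | v in G x A b].

(* The point (x, a, b, u) of R^n x R^(mn) x R^m x R^d; [mxvec] lists the rows
   of A one after the other. *)
Definition pack x A b u : 'rV[R]_(n + m * n + m + d) :=
  row_mx (row_mx (row_mx x (mxvec A)) b) u.

Definition unpacked (T : Type)
    (f : 'rV[R]_n -> 'M[R]_(m, n) -> 'rV[R]_m -> 'rV[R]_d -> T)
    (z : 'rV[R]_(n + m * n + m + d)) : T :=
  f (lsubmx (lsubmx (lsubmx z))) (vec_mx (rsubmx (lsubmx (lsubmx z))))
    (rsubmx (lsubmx z)) (rsubmx z).

Definition multipliers x A b (v : 'rV[R]_n) : set 'rV[R]_m :=
  [set p | normal_cone orthant_nonpos (x *m A^T - b) p /\ p *m A = v].

Definition normal_orthant_coder x A b (p : 'rV[R]_m) (y : 'rV[R]_n) :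
    set 'rV[R]_m :=
  coderivative (normal_cone orthant_nonpos) (x *m A^T - b) p (y *m A^T).

Definition coder_estimate (g : 'rV[R]_n * 'rV[R]_d -> 'rV[R]_n) x A b u
    (w y : 'rV[R]_n) : set 'rV[R]_(n + m * n + m + d) :=
  \bigcup_(p in multipliers x A b (w + g (x, u)))
    [set pack (q *m A - y *m (grad_x g x u)^T)
              (\matrix_(i < m) (p 0 i *: y + q 0 i *: x))
              (- q)
              (- (y *m (grad_u g x u)^T))
       | q in normal_orthant_coder x A b p y].

End Polyhedra.

(* Main.v *)
Require Import Defs.
From HB Require Import structures.
From mathcomp Require Import all_boot all_order all_algebra.
From mathcomp Require Import all_classical all_reals all_analysis.
From mathcomp Require Import ring lra.

Set Implicit Arguments.
Unset Strict Implicit.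
Unset Printing Implicit Defensive.

Import Order.TTheory GRing.Theory Num.Theory.
Import numFieldNormedType.Exports.

Local Open Scope classical_set_scope.
Local Open Scope ring_scope.

(** Let Gamma be the graph of the normal cone mapping of the nonpositive orthant:
    the pairs (s, p) with s <= 0 <= p and s_i p_i = 0 for all i.  By Farkas'
    lemma the normals to the polyhedron C(A, b) at x are the vectors p A with
    (A x - b, p) in Gamma ([G_multipliers]).  Hence the graph of F is the image
    of the set of all (x, A, u, s, p) with (s, p) in Gamma under the C^1 map
      (x, A, u, s, p) |-> (x, A, b, u, w) with b = A x - s, w = p A - g (x, u).

    Upper estimate.  A regular (Frechet) normal to an image is pulled back, by
    the adjoint of the derivative, to a regular normal of the source.  For the
    map above the adjoint is explicit: x, A and u are free variables, so their
    components vanish, which gives three blocks of the estimate with q the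
    opposite of the b-component, and the components along s and p say that
    (q, - A y) is normal to Gamma.
    This is [regular_normal_graph_F], proved along curves.  A limiting normal
    is a limit of regular ones; positive linear independence of the active rows
    keeps the multipliers p bounded ([near_multipliers_bounded]), so that a
    limit p exists and all these relations pass to the limit
    ([coderivative_F_upper]).

    Equality.  If the active rows are linearly independent, p is recovered
    continuously from the point of the graph.  Moreover, for a regular normal
    (q', - h) of Gamma near (q, - A y) there is y' near y with (A y')_i = h_i for
    all active i, and then q', y' and the multiplier define a regular normal of
    the graph of F: in its defining inequality the first-order terms cancel, up
    to those of Gamma, and what is left is of order |dx| |dA| and |dp| |dA|,
    besides the remainder of g
    ([regular_normal_graph_F_lift]).  Limits give the reverse inclusion
    ([coder_estimate_lower]).

    The signs of q are read off Gamma, which is a product of m planar unions of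
    two half-lines ([normal_cone_graph_orthant_sign]).

    Limits are expressed by closures throughout: the limiting normal cone of a
    locally closed set at z is the set of v with (z, v) in the closure of the
    set of pairs (point, regular normal at that point)
    ([normal_cone_closure_regular] and [closure_regular_normal_cone]). *)

(** * The inner product and norm bounds *)

Section Dot.
Variable R : realType.

Lemma dotE s (u v : 'rV[R]_s) : dot u v = (u *m v^T) 0 0.
Proof. by rewrite mxE; apply: eq_bigr => i _; rewrite mxE. Qed.

Lemma dotC s (u v : 'rV[R]_s) : dot u v = dot v u.
Proof. by apply: eq_bigr => i _; rewrite mulrC. Qed.

Lemma dotDl s (u v w : 'rV[R]_s) : dot (u + v) w = dot u w + dot v w.
Proof. by rewrite !dotE mulmxDl mxE. Qed.

Lemma dotZl s a (u v : 'rV[R]_s) : dot (a *: u) v = a * dot u v.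
Proof. by rewrite !dotE -scalemxAl mxE. Qed.

Lemma dotNl s (u v : 'rV[R]_s) : dot (- u) v = - dot u v.
Proof. by rewrite -scaleN1r dotZl mulN1r. Qed.

Lemma dotBl s (u v w : 'rV[R]_s) : dot (u - v) w = dot u w - dot v w.
Proof. by rewrite dotDl dotNl. Qed.

Lemma dotDr s (u v w : 'rV[R]_s) : dot u (v + w) = dot u v + dot u w.
Proof. by rewrite !(dotC u) dotDl. Qed.

Lemma dotZr s a (u v : 'rV[R]_s) : dot u (a *: v) = a * dot u v.
Proof. by rewrite !(dotC u) dotZl. Qed.

Lemma dotNr s (u v : 'rV[R]_s) : dot u (- v) = - dot u v.
Proof. by rewrite !(dotC u) dotNl. Qed.

Lemma dotBr s (u v w : 'rV[R]_s) : dot u (v - w) = dot u v - dot u w.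
Proof. by rewrite !(dotC u) dotBl. Qed.

Lemma dot_sqrB s (u v : 'rV[R]_s) :
  dot (u - v) (u - v) = dot u u - 2 * dot u v + dot v v.
Proof. by rewrite dotBl !dotBr (dotC v u); ring. Qed.

Lemma dot0l s (u : 'rV[R]_s) : dot 0 u = 0.
Proof. by rewrite dotE mul0mx mxE. Qed.

Lemma dot0r s (u : 'rV[R]_s) : dot u 0 = 0.
Proof. by rewrite dotC dot0l. Qed.

Lemma dot_mulmxl s t (u : 'rV[R]_s) (M : 'M[R]_(s, t)) v :
  dot (u *m M) v = dot u (v *m M^T).
Proof. by rewrite !dotE trmx_mul trmxK mulmxA. Qed.

Lemma dot_deltar s (u : 'rV[R]_s) i : dot u (delta_mx 0 i) = u 0 i.
Proof.
rewrite /dot (bigD1 i)//= mxE !eqxx mulr1 big1 ?addr0// => j ji.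
by rewrite mxE (negPf ji) mulr0.
Qed.

Lemma dot_inj s (u v : 'rV[R]_s) : (forall h, dot u h = dot v h) -> u = v.
Proof. by move=> uv; apply/rowP => i; rewrite -!dot_deltar. Qed.

Lemma dot_row_mx s t (u u' : 'rV[R]_s) (v v' : 'rV[R]_t) :
  dot (row_mx u v) (row_mx u' v') = dot u u' + dot v v'.
Proof. by rewrite !dotE tr_row_mx mul_row_col mxE. Qed.

Lemma dot_mxvec m n (M N : 'M[R]_(m, n)) : dot (mxvec M) (mxvec N) = \tr (M *m N^T).
Proof.
rewrite /dot (reindex _ (curry_mxvec_bij _ _)) /=.
rewrite (eq_bigr (fun ij : 'I_m * 'I_n => M ij.1 ij.2 * N ij.1 ij.2)); last first.
  by move=> [i j] _; rewrite /= !mxvecE.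
rewrite -(pair_bigA _ (fun i j => M i j * N i j)) /=.
apply: eq_bigr => i _; rewrite mxE; apply: eq_bigr => j _.
by rewrite mxE.
Qed.

(** The matrix with rows p_i y + q_i x of the estimate is a sum of two such
    outer products. *)
Lemma dot_mxvec_outer m n (p : 'rV[R]_m) (y : 'rV[R]_n) (H : 'M[R]_(m, n)) :
  dot (mxvec (p^T *m y)) (mxvec H) = dot p (y *m H^T).
Proof. by rewrite dot_mxvec -mulmxA mxtrace_mulC trace_mx11 -dotE dotC. Qed.

Lemma row_mul_tr m n (x : 'rV[R]_n) (A : 'M[R]_(m, n)) i :
  (x *m A^T) 0 i = dot (row i A) x.
Proof. by rewrite dotC dotE tr_row !mxE; apply: eq_bigr => j _; rewrite !mxE. Qed.

Lemma dot_self_ge0 s (u : 'rV[R]_s) : 0 <= dot u u.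
Proof. by apply: sumr_ge0 => i _; rewrite -expr2 sqr_ge0. Qed.

Lemma coord_le_norm m n (M : 'M[R]_(m, n)) i j : `|M i j| <= `|M|.
Proof.
rewrite [leRHS]/Num.norm /= mx_normrE; apply/bigmax_geP; right => /=.
by exists (i, j).
Qed.

Lemma norm_le_coord m n (M : 'M[R]_(m, n)) c :
  0 <= c -> (forall i j, `|M i j| <= c) -> `|M| <= c.
Proof.
move=> c0 Mc; rewrite [leLHS]/Num.norm /= mx_normrE; apply/bigmax_leP.
by split=> // -[i j] _ /=.
Qed.

Lemma norm_mulmx_le m n k (M : 'M[R]_(m, n)) (N : 'M[R]_(n, k)) :
  `|M *m N| <= n%:R * `|M| * `|N|.
Proof.
apply: norm_le_coord => [|i j]; first by rewrite !mulr_ge0.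
rewrite mxE (le_trans (ler_norm_sum _ _ _))//.
have: \sum_(l < n) `|M i l * N l j| <= \sum_(l < n) `|M| * `|N|.
  by apply: ler_sum => l _; rewrite normrM ler_pM// coord_le_norm.
by rewrite sumr_const card_ord -[X in _ <= X]mulr_natl mulrA.
Qed.

Lemma norm_trmx m n (M : 'M[R]_(m, n)) : `|M^T| = `|M|.
Proof.
apply/eqP; rewrite eq_le; apply/andP; split; apply: norm_le_coord => // i j.
  by rewrite mxE coord_le_norm.
by have := coord_le_norm M^T j i; rewrite mxE.
Qed.

Lemma norm_dot_le s (u v : 'rV[R]_s) : `|dot u v| <= s%:R * `|u| * `|v|.
Proof.
rewrite dotE; apply: le_trans (coord_le_norm _ _ _) _.
by rewrite -(norm_trmx v) norm_mulmx_le.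
Qed.

Lemma sqr_norm_le_dot s (u : 'rV[R]_s) : `|u| ^+ 2 <= dot u u.
Proof.
rewrite -(@ler_sqrt R)// ?exprn_ge0 ?dot_self_ge0// sqrtr_sqr normr_id.
apply: norm_le_coord => [|i j]; first exact: sqrtr_ge0.
rewrite -sqrtr_sqr ler_sqrt ?dot_self_ge0// ord1.
rewrite /dot (bigD1 j)//= expr2 lerDl.
by apply: sumr_ge0 => k _; rewrite -expr2 sqr_ge0.
Qed.

Lemma dot_self_eq0 s (u : 'rV[R]_s) : dot u u <= 0 -> u = 0.
Proof.
move=> u0; apply/eqP; rewrite -normr_le0 -[leLHS]ger0_norm// -sqrtr_sqr.
by rewrite ler0_sqrtr// (le_trans (sqr_norm_le_dot u)).
Qed.

Lemma norm_row_mx_l s t (u : 'rV[R]_s) (v : 'rV[R]_t) : `|u| <= `|row_mx u v|.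
Proof.
apply: norm_le_coord => // i j; rewrite -(row_mxEl u v) .
exact: coord_le_norm.
Qed.

Lemma norm_row_mx_r s t (u : 'rV[R]_s) (v : 'rV[R]_t) : `|v| <= `|row_mx u v|.
Proof.
apply: norm_le_coord => // i j; rewrite -(row_mxEr u v).
exact: coord_le_norm.
Qed.

Lemma norm_mxvec m n (M : 'M[R]_(m, n)) : `|M| <= `|mxvec M|.
Proof.
apply: norm_le_coord => // i j; rewrite -mxvecE; exact: coord_le_norm.
Qed.

End Dot.

(** * Convergence of matrix expressions *)

Section Convergence.
Variable R : realType.
Context {T : Type} {F : set_system T} {FF : Filter F}.

(** Unlike [f @ F], which hides a coercion of [F] to a filter, this form lets
    unification find [F] when it is the filter of neighbourhoods of a matrix. *)
Local Notation "f @@ F --> l" := (cvg_to (fmap f F) (nbhs l))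
  (at level 70, F at next level).

Lemma cvg_const (V : topologicalType) (a : V) : (fun=> a) @@ F --> a.
Proof. exact: cvg_cst. Qed.

Lemma cvg_to_pair (V W : topologicalType) (f : T -> V) (g : T -> W) (a : V) (b : W) :
  f @@ F --> a -> g @@ F --> b -> (fun t => (f t, g t)) @@ F --> (a, b).
Proof. exact: cvg_pair. Qed.

Lemma cvg_to_fst (V W : topologicalType) (f : T -> V * W) (z : V * W) :
  f @@ F --> z -> (fun t => (f t).1) @@ F --> z.1.
Proof. by case: z => a b fz; apply: cvg_comp fz cvg_fst. Qed.

Lemma cvg_to_snd (V W : topologicalType) (f : T -> V * W) (z : V * W) :
  f @@ F --> z -> (fun t => (f t).2) @@ F --> z.2.
Proof. by case: z => a b fz; apply: cvg_comp fz cvg_snd. Qed.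

Lemma cvg_mx m n (f : T -> 'M[R]_(m, n)) (M : 'M[R]_(m, n)) :
  (forall i j, (fun t => f t i j) @@ F --> M i j) -> f @@ F --> M.
Proof.
move=> fM S [P MP PS]; rewrite /nbhs/=; near=> t; apply: PS.
near: t; apply: filter_forall => i; apply: filter_forall => j.
exact: fM (MP i j).
Unshelve. all: by end_near. Qed.

Lemma cvg_entry m n (f : T -> 'M[R]_(m, n)) (M : 'M[R]_(m, n)) i j :
  f @@ F --> M -> (fun t => f t i j) @@ F --> M i j.
Proof. by move=> fM; apply: (continuous_cvg _ (@coord_continuous _ _ _ i j M)). Qed.

Lemma cvg_lsubmx m n1 n2 (f : T -> 'M[R]_(m, n1 + n2)) (M : 'M[R]_(m, n1 + n2)) :
  f @@ F --> M -> (fun t => lsubmx (f t)) @@ F --> lsubmx M.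
Proof.
by move=> fM; apply: cvg_mx => i j; rewrite mxE; under eq_fun do rewrite mxE;
  exact: cvg_entry.
Qed.

Lemma cvg_rsubmx m n1 n2 (f : T -> 'M[R]_(m, n1 + n2)) (M : 'M[R]_(m, n1 + n2)) :
  f @@ F --> M -> (fun t => rsubmx (f t)) @@ F --> rsubmx M.
Proof.
by move=> fM; apply: cvg_mx => i j; rewrite mxE; under eq_fun do rewrite mxE;
  exact: cvg_entry.
Qed.

Lemma cvg_trmx m n (f : T -> 'M[R]_(m, n)) (M : 'M[R]_(m, n)) :
  f @@ F --> M -> (fun t => (f t)^T) @@ F --> M^T.
Proof.
by move=> fM; apply: cvg_mx => i j; rewrite mxE; under eq_fun do rewrite mxE;
  exact: cvg_entry.
Qed.

Lemma cvg_vec_mx m n (f : T -> 'rV[R]_(m * n)) (M : 'rV[R]_(m * n)) :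
  f @@ F --> M -> (fun t => vec_mx (f t) : 'M[R]_(m, n)) @@ F --> vec_mx M.
Proof.
by move=> fM; apply: cvg_mx => i j; rewrite mxE; under eq_fun do rewrite mxE;
  exact: cvg_entry.
Qed.

Lemma cvg_mxvec m n (f : T -> 'M[R]_(m, n)) (M : 'M[R]_(m, n)) :
  f @@ F --> M -> (fun t => mxvec (f t)) @@ F --> mxvec M.
Proof.
move=> fM; apply: cvg_mx => i k; rewrite ord1.
case/mxvec_indexP: k => i' j; rewrite mxvecE; under eq_fun do rewrite mxvecE.
exact: cvg_entry.
Qed.

Lemma cvg_row_mx m n1 n2 (f : T -> 'M[R]_(m, n1)) (g : T -> 'M[R]_(m, n2)) (M : 'M[R]_(m, n1)) (N : 'M[R]_(m, n2)) :
  f @@ F --> M -> g @@ F --> N -> (fun t => row_mx (f t) (g t)) @@ F --> row_mx M N.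
Proof.
move=> fM gN; apply: cvg_mx => i j; rewrite mxE; under eq_fun do rewrite mxE.
by case: (fintype.split j) => k; exact: cvg_entry.
Qed.

Lemma cvg_sumr (I : finType) (f : I -> T -> R) (l : I -> R) :
  (forall i, f i @@ F --> l i) -> (fun t => \sum_i f i t) @@ F --> \sum_i l i.
Proof.
move=> fl; have add_cont := @add_continuous R.
apply: (@cvg_big R I +%R 0 predT add_cont T F (index_enum I) f l) => // i _.
exact: fl.
Qed.

Lemma cvg_add (f g : T -> R) (a b : R) :
  f @@ F --> a -> g @@ F --> b -> (fun t => f t + g t) @@ F --> a + b.
Proof. exact: cvgD. Qed.

Lemma cvg_sub (f g : T -> R) (a b : R) :
  f @@ F --> a -> g @@ F --> b -> (fun t => f t - g t) @@ F --> a - b.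
Proof. exact: cvgB. Qed.

Lemma cvg_mul (f g : T -> R) (a b : R) :
  f @@ F --> a -> g @@ F --> b -> (fun t => f t * g t) @@ F --> a * b.
Proof. exact: cvgM. Qed.

Lemma cvg_mulmx m n k (f : T -> 'M[R]_(m, n)) (g : T -> 'M[R]_(n, k)) (M : 'M[R]_(m, n)) (N : 'M[R]_(n, k)) :
  f @@ F --> M -> g @@ F --> N -> (fun t => f t *m g t) @@ F --> M *m N.
Proof.
move=> fM gN; apply: cvg_mx => i j; rewrite mxE; under eq_fun do rewrite mxE.
apply: (@cvg_sumr _ (fun l t => f t i l * g t l j)) => l.
by apply: cvgM; exact: cvg_entry.
Qed.

Lemma cvg_addmx m n (f g : T -> 'M[R]_(m, n)) (M N : 'M[R]_(m, n)) :
  f @@ F --> M -> g @@ F --> N -> (fun t => f t + g t) @@ F --> M + N.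
Proof.
move=> fM gN; apply: cvg_mx => i j; rewrite mxE; under eq_fun do rewrite mxE.
by apply: cvgD; exact: cvg_entry.
Qed.

Lemma cvg_oppmx m n (f : T -> 'M[R]_(m, n)) (M : 'M[R]_(m, n)) :
  f @@ F --> M -> (fun t => - f t) @@ F --> - M.
Proof.
move=> fM; apply: cvg_mx => i j; rewrite mxE; under eq_fun do rewrite mxE.
by apply: cvgN; exact: cvg_entry.
Qed.

Lemma cvg_subrmx m n (f g : T -> 'M[R]_(m, n)) (M N : 'M[R]_(m, n)) :
  f @@ F --> M -> g @@ F --> N -> (fun t => f t - g t) @@ F --> M - N.
Proof. by move=> fM gN; apply: cvg_addmx => //; exact: cvg_oppmx. Qed.

Lemma cvg_scalemx m n (a : T -> R) (f : T -> 'M[R]_(m, n)) (c : R) (M : 'M[R]_(m, n)) :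
  a @@ F --> c -> f @@ F --> M -> (fun t => a t *: f t) @@ F --> c *: M.
Proof.
move=> ac fM; apply: cvg_mx => i j; rewrite mxE; under eq_fun do rewrite mxE.
by apply: cvgM => //; exact: cvg_entry.
Qed.

Lemma cvg_dot s (f g : T -> 'rV[R]_s) (u v : 'rV[R]_s) :
  f @@ F --> u -> g @@ F --> v -> (fun t => dot (f t) (g t)) @@ F --> dot u v.
Proof.
move=> fu gv; apply: (@cvg_sumr _ (fun l t => f t 0 l * g t 0 l)) => l.
by apply: cvgM; exact: cvg_entry.
Qed.

Lemma cvg_normmx m n (f : T -> 'M[R]_(m, n)) (M : 'M[R]_(m, n)) :
  f @@ F --> M -> (fun t => `|f t|) @@ F --> `|M|.
Proof. exact: cvg_norm. Qed.

Lemma cvg_enorm s (f : T -> 'rV[R]_s) (u : 'rV[R]_s) :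
  f @@ F --> u -> (fun t => enorm (f t)) @@ F --> enorm u.
Proof.
by move=> fu; apply: (continuous_cvg _ (@sqrt_continuous R _)); apply: cvg_dot.
Qed.

End Convergence.

(** * Passage to the limit through closures *)

Section Closure.

(** Closures replace sequences in every limit argument below; the condition is
    required near [z] only, as the normals and multipliers at hand are controlled
    only locally. *)
Lemma closure_le (R : realType) (T : topologicalType) (K : set T) (f g : T -> R) z :
  closure K z -> f @ z --> f z -> g @ z --> g z ->
  (\forall t \near z, K t -> f t <= g t) -> f z <= g z.
Proof.
move=> Kz fz gz fg; rewrite leNgt; apply/negP => gf.
have /Kz[t [Kt []]] : nbhs z ([set t | g t < f t] `&` [set t | K t -> f t <= g t]).
  apply: filterI => //.
  have : (fun t => f t - g t) @ z --> f z - g z by apply: cvgB.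
  move=> /cvgr_gt /(_ 0); rewrite subr_gt0 => /(_ gf).
  by apply: filterS => t; rewrite subr_gt0.
by move=> /= gf' /(_ Kt); rewrite leNgt gf'.
Qed.

Lemma closure_eq (R : realType) (T : topologicalType) (K : set T) (f g : T -> R) z :
  closure K z -> f @ z --> f z -> g @ z --> g z ->
  (\forall t \near z, K t -> f t = g t) -> f z = g z.
Proof.
move=> Kz fz gz fg; apply/eqP; rewrite eq_le.
by rewrite !(closure_le Kz)//; apply: filterS fg => t fg /fg ->.
Qed.

Lemma closure_eq_mx (R : realType) m n (T : topologicalType) (K : set T)
    (f g : T -> 'M[R]_(m, n)) z :
  closure K z -> f @ z --> f z -> g @ z --> g z ->
  (\forall t \near z, K t -> f t = g t) -> f z = g z.
Proof.
move=> Kz fz gz fg; apply/matrixP => i j.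
apply: (@closure_eq _ _ K (fun t => f t i j) (fun t => g t i j)) => //; try exact: cvg_entry.
by apply: filterS fg => t fg /fg ->.
Qed.

Lemma closure_near (T : topologicalType) (K : set T) (P : set T) z :
  closure K z -> (\forall t \near z, P t) -> closure (K `&` P) z.
Proof.
move=> Kz Pz B Bz; have [t [Kt [Bt Pt]]] := Kz _ (filterI Bz Pz).
by exists t.
Qed.

Lemma closure_map (T1 T2 : topologicalType) (K : set T1) (L : set T2) (f : T1 -> T2) z :
  closure K z -> f @ z --> f z -> (\forall t \near z, K t -> L (f t)) ->
  closure L (f z).
Proof.
move=> Kz fz KL B /fz Bz; have [t [Kt [/= Bt Lt]]] := Kz _ (@filterI _ (nbhs z) _ _ _ Bz KL).
by exists (f t); split => //; exact: Lt.
Qed.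

Lemma closed_ball_norm_closed (R : realType) s (z : 'rV[R]_s) r :
  closed [set w : 'rV[R]_s | `|w - z| <= r].
Proof.
move=> w wcl /=.
have := @closure_le _ _ _ (fun w : 'rV[R]_s => `|w - z|) (fun=> r) _ wcl; apply.
- by apply: cvg_normmx; apply: cvg_subrmx => //; exact: cvg_const.
- exact: cvg_const.
- by near=> t.
Unshelve. all: by end_near. Qed.

Lemma closed_ball_norm_compact (R : realType) s (z : 'rV[R]_s) r :
  compact [set w : 'rV[R]_s | `|w - z| <= r].
Proof.
apply: bounded_closed_compact.
  exists (r + `|z|); split; first by rewrite num_real.
  move=> M rM w /= wz; rewrite -(subrK z w).
  by rewrite (le_trans (ler_normD _ _))// (le_trans _ (ltW rM))// lerD2r.
exact: closed_ball_norm_closed.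
Qed.

(** Projecting along a bounded Euclidean factor is a closed map, by
    compactness of balls. *)
Lemma closure_bounded_snd (R : realType) (T : topologicalType) m
    (K : set (T * 'rV[R]_m)) (t : T) M :
  (\forall t' \near t, forall p, K (t', p) -> `|p| <= M) ->
  closure [set t' | exists p, K (t', p)] t -> exists p, closure K (t, p).
Proof.
move=> KM Kt; apply: contrapT => /forallNP noK.
have /compact_near_coveringP cov := @closed_ball_norm_compact R m 0 M.
have : \forall t' \near t, [set w : 'rV[R]_m | `|w - 0| <= M] `<=` (fun p => ~ K (t', p)).
  apply: (cov T (nbhs t) (fun t' p => ~ K (t', p))) => p _.
  have /existsNP[B /not_implyP[[[U V] [/= Ut Vp] UVB] KB]] := noK p.
  exists (V, U); first by split.
  move=> [p' t'] /= [Vp' Ut'] Ktp; apply: KB.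
  by exists (t', p'); split => //; exact: UVB.
move=> /(filterI KM) KM'.
have [t' [[p Kp] [Mp /= Kn]]] := Kt _ KM'.
by apply: (Kn p) => //=; rewrite subr0; exact: Mp.
Qed.

End Closure.

(** * Regular, proximal and limiting normals *)

Section RegularNormals.
Variable R : realType.

(** Regular (Frechet) normals.  The limiting normal cone is defined through
    projections, that is through proximal normals, which a change of variables
    that is merely C^1 does not preserve; regular normals are stable under such
    changes, and have the same limits. *)
Definition regular_normal s (Omega : set 'rV[R]_s) (w v : 'rV[R]_s) : Prop :=
  Omega w /\ forall e, 0 < e -> \forall w' \near w,
    Omega w' -> dot v (w' - w) <= e * `|w' - w|.

Definition regular_normals s (Omega : set 'rV[R]_s) : set ('rV[R]_s * 'rV[R]_s) :=
  [set zv | regular_normal Omega zv.1 zv.2].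

Definition proximal_normals s (Omega : set 'rV[R]_s) : set ('rV[R]_s * 'rV[R]_s) :=
  [set zv | cone [set zv.1 - w | w in projector Omega zv.1] zv.2].

Definition locally_closed s (Omega : set 'rV[R]_s) (z : 'rV[R]_s) : Prop :=
  \forall z' \near z, closure Omega z' -> Omega z'.

Lemma closed_locally_closed s (Omega : set 'rV[R]_s) z :
  closed Omega -> locally_closed Omega z.
Proof. by move=> cl; near=> t; exact: cl.
Unshelve. all: by end_near. Qed.

Lemma le_enorm s (u v : 'rV[R]_s) : (enorm u <= enorm v) = (dot u u <= dot v v).
Proof. by rewrite /enorm ler_sqrt ?dot_self_ge0. Qed.

Lemma norm_le_enorm s (u : 'rV[R]_s) : `|u| <= enorm u.
Proof.
rewrite -[leLHS]ger0_norm// -sqrtr_sqr /enorm ler_sqrt ?dot_self_ge0//.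
exact: sqr_norm_le_dot.
Qed.

Lemma enormZ s a (u : 'rV[R]_s) : 0 <= a -> enorm (a *: u) = a * enorm u.
Proof.
move=> a0; rewrite /enorm dotZl dotZr mulrA -expr2 sqrtrM ?sqr_ge0//.
by rewrite sqrtr_sqr ger0_norm.
Qed.

Lemma near_norm_lt m n (M : 'M[R]_(m, n)) e :
  0 < e -> \forall N \near M, `|N - M| < e.
Proof.
move=> e0; apply/nbhs_normP; exists e => // N; rewrite /ball_ /= distrC.
by [].
Qed.

(** The defining inequality, divided by [t], passes to the limit; this is how
    every constraint on a normal is extracted from a curve. *)
Lemma regular_normal_tangent s (Omega : set 'rV[R]_s) w v (c : R -> 'rV[R]_s) (e : 'rV[R]_s) :
  regular_normal Omega w v ->
  (\forall t \near 0^'+, Omega (c t)) ->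
  (fun t => t^-1 *: (c t - w)) @ 0^'+ --> e ->
  dot v e <= 0.
Proof.
move=> [_ vw] Oc ce.
have idt : (fun t : R => t) @ 0^'+ --> (0 : R) by exact: cvg_at_right_filter.
have cw : c @ 0^'+ --> w.
  have : (fun t => w + t *: (t^-1 *: (c t - w))) @ 0^'+ --> w + 0 *: e.
    by apply: cvg_addmx; [exact: cvg_const | exact: cvg_scalemx].
  rewrite scale0r addr0; apply: cvg_trans; apply: near_eq_cvg.
  near=> t; rewrite scalerA divff ?scale1r ?subrKC//.
have main d : 0 < d -> dot v e <= d * `|e|.
  move=> d0.
  have := @ler_cvg_to _ _ (at_right_proper_filter (0 : R)) R
    (fun t => dot v (t^-1 *: (c t - w))) (fun t => d * `|t^-1 *: (c t - w)|).
  apply.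
  - by apply: cvg_dot => //; exact: cvg_const.
  - by apply: cvgM; [exact: cvg_cst | exact: cvg_normmx].
  have cvw : \forall t \near 0^'+, Omega (c t) -> dot v (c t - w) <= d * `|c t - w|.
    exact: (cw _ (vw d d0)).
  near=> t; have t0 : 0 < t by near: t; exact: nbhs_right_gt.
  rewrite /= dotZr normrZ ger0_norm ?invr_ge0 ?(ltW t0)// [leRHS]mulrCA ler_pM2l ?invr_gt0//.
  have /= : Omega (c t) by near: t.
  by near: t; exact: cvw.
rewrite leNgt; apply/negP => ve.
have e1 : 0 < `|e| + 1 by rewrite ltr_wpDl.
have := main (dot v e / (`|e| + 1)) (divr_gt0 ve e1).
rewrite -mulrA -[X in X <= _]mulr1 ler_pM2l// mulrC ler_pdivlMr// mul1r.
by rewrite gerDl ler10.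
Unshelve. all: by end_near. Qed.

(** Squaring, minimality of [|z - w|] bounds [dot (z - w) d] by half the square
    of the length of a move [d] within the set, which is of second order. *)
Lemma proximal_regular_normal s (Omega : set 'rV[R]_s) z w t :
  0 <= t -> projector Omega z w -> regular_normal Omega w (t *: (z - w)).
Proof.
move=> t0 [Ow wmin]; split => // e e0.
have ts : 0 < t * s%:R + 1 by rewrite ltr_wpDl// mulr_ge0.
near=> w' => Ow'.
have : `|w' - w| < e / (t * s%:R + 1).
  by near: w'; apply: near_norm_lt; exact: divr_gt0.
rewrite ltr_pdivlMr// => dlt.
have := wmin _ Ow'; rewrite le_enorm.
have -> : z - w' = (z - w) - (w' - w) by rewrite opprB addrA subrK.
move: (z - w) (w' - w) dlt => a d dlt; rewrite dot_sqrB dotZl => ad.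
have := norm_dot_le d d; rewrite ger0_norm ?dot_self_ge0// => dd.
have {ad dd} : 2 * dot a d <= s%:R * `|d| * `|d| by lra.
move=> /(ler_wpM2l t0) tad.
have : `|d| * (t * s%:R + 1) * `|d| <= e * `|d| by rewrite ler_wpM2r// ltW.
have : 0 <= `|d| * `|d| by rewrite mulr_ge0.
have : 0 <= e * `|d| by rewrite mulr_ge0// ltW.
lra.
Unshelve. all: by end_near. Qed.

(** First countability turns the sequences of the definition into a closure. *)
Lemma normal_coneE s (Omega : set 'rV[R]_s) z v :
  normal_cone Omega z v <-> Omega z /\ closure (proximal_normals Omega) (z, v).
Proof.
split=> [[Oz [zk [vk [zkz vkv zvk]]]]|[Oz cl]].
  split=> // B Bz; have [k Bk] := @filter_ex _ \oo _ _ (cvg_pair zkz vkv Bz).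
  by exists (zk k, vk k); split; [exact: zvk|].
split=> //.
have /choice[f fP] k : exists zv, proximal_normals Omega zv /\
    (`|zv.1 - z| < k.+1%:R^-1 /\ `|zv.2 - v| < k.+1%:R^-1).
  apply: cl.
  have k0 : 0 < k.+1%:R^-1 :> R by rewrite invr_gt0.
  exists ([set z' : 'rV[R]_s | `|z' - z| < k.+1%:R^-1],
          [set v' : 'rV[R]_s | `|v' - v| < k.+1%:R^-1]).
    by split; exact: near_norm_lt.
  by move=> [].
exists (fun k => (f k).1), (fun k => (f k).2); split.
- apply/cvgrPdist_lt => e e0; near=> k; rewrite distrC.
  apply: lt_trans (fP k).2.1 _.
  by near: k; exact: near_infty_natSinv_lt (PosNum e0).
- apply/cvgrPdist_lt => e e0; near=> k; rewrite distrC.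
  apply: lt_trans (fP k).2.2 _.
  by near: k; exact: near_infty_natSinv_lt (PosNum e0).
by move=> k; exact: (fP k).1.
Unshelve. all: by end_near. Qed.

(** Proximal normals are regular at the projected point, which tends to [z]
    because it is no farther from the projected one than [z] is. *)
Lemma normal_cone_closure_regular s (Omega : set 'rV[R]_s) z v :
  normal_cone Omega z v -> closure (regular_normals Omega) (z, v).
Proof.
move=> [Oz [zk [vk [zkz vkv zvk]]]].
have /choice[wk wkP] k : exists w, projector Omega (zk k) w /\
    regular_normal Omega w (vk k).
  have [t [_ [t0 [w pw <-] ->]]] := zvk k.
  by exists w; split => //; exact: proximal_regular_normal.
have wkz : wk @ \oo --> z.
  apply/cvgrPdist_lt => e e0.
  have : (fun k => enorm (zk k - z) + `|zk k - z|) @ \oo --> enorm (z - z) + `|z - z|.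
    by apply: cvgD; [apply: cvg_enorm | apply: cvg_normmx];
      apply: cvg_subrmx => //; exact: cvg_const.
  rewrite subrr normr0 addr0 /enorm dot0l sqrtr0 => /cvgr_lt/(_ _ e0) nk.
  near=> k; apply: (@le_lt_trans _ _ (enorm (zk k - z) + `|zk k - z|)).
    have [[_ wmin] _] := wkP k.
    rewrite distrC -(subrK (zk k) (wk k)) -addrA (le_trans (ler_normD _ _))//.
    by rewrite lerD2r distrC (le_trans (norm_le_enorm _))// wmin.
  by near: k.
move=> B Bz; have [k Bk] := @filter_ex _ \oo _ _ (cvg_pair wkz vkv Bz).
by exists (wk k, vk k); split => //; have [] := wkP k.
Unshelve. all: by end_near. Qed.

Lemma near_right_mul_lt K c : 0 < c -> \forall t \near (0 : R)^'+, t * K < c.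
Proof.
move=> c0; have : (fun t : R => t * K) @ 0^'+ --> 0 * K.
  by apply: cvgM; [exact: cvg_at_right_filter | exact: cvg_cst].
by rewrite mul0r => /cvgr_lt; apply.
Qed.

Lemma exists_projection s (D : set 'rV[R]_s) z w :
  compact D -> D w -> exists w0, projector D z w0.
Proof.
move=> Dc Dw.
have De : {within D, continuous (fun w' : 'rV[R]_s => enorm (z - w'))}.
  apply: continuous_subspaceT => w'; apply: cvg_enorm.
  by apply: cvg_subrmx => //; exact: cvg_const.
have [|w0 /set_mem Dw0 w0min] := EVT_min_rV _ Dc De; first by exists w.
by exists w0; split => // w' Dw'; apply: w0min; exact/mem_set.
Qed.

(** Projecting [w + t v] onto the set for small [t > 0] gives proximal normals
    close to [v]: the projection is within o(t) of [w]. *)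
Lemma regular_normal_closure_proximal s (Omega : set 'rV[R]_s) w v :
  locally_closed Omega w -> regular_normal Omega w v ->
  closure (proximal_normals Omega) (w, v).
Proof.
move=> lc [Ow vreg] B [[U V] /= [/nbhs_normP[eu eu0 Uw] /nbhs_normP[ev ev0 Vv]] UVB].
have [r r0 Or] := (nbhs_normP _ _).1 lc.
pose D := [set w' | `|w' - w| <= r / 2] `&` Omega.
have r2 : 0 < r / 2 by rewrite divr_gt0.
have cD : compact D.
  apply: (subclosed_compact _ (@closed_ball_norm_compact R s w (r / 2))) => [|?[]//].
  move=> w' w'D.
  have w'r : `|w' - w| <= r / 2.
    by apply: closed_ball_norm_closed; apply: closureS w'D => ? [].
  split=> //; apply: Or; last by apply: closureS w'D => ? [].
  by rewrite /ball_ /= distrC (le_lt_trans w'r)// ltr_pdivrMr// ltr_pMr// ltr1n.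
have Dw : D w by split=> //=; rewrite subrr normr0 ltW.
have ev3 : 0 < ev / 3 by rewrite divr_gt0.
have [d d0 vd] := (nbhs_normP _ _).1 (vreg _ ev3).
near (0 : R)^'+ => t.
have t0 : 0 < t by near: t; exact: nbhs_right_gt.
have tr : t * (enorm v + `|v|) < r / 2 by near: t; exact: near_right_mul_lt.
have td : t * (enorm v + `|v|) < d by near: t; exact: near_right_mul_lt.
have tu : t * `|v| < eu by near: t; exact: near_right_mul_lt.
have [w0 [[w0r Ow0] w0min]] := exists_projection (w + t *: v) cD Dw.
have zw : w + t *: v - w = t *: v by rewrite addrAC subrr add0r.
have zw0 : enorm (w + t *: v - w0) <= t * enorm v.
  by rewrite -(enormZ v (ltW t0)) -[in leRHS]zw; exact: w0min.
(* a competitor outside the ball is no nearer to [w + t *: v] than [w] is *)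
have Pw0 : projector Omega (w + t *: v) w0.
  split=> // w' Ow'; have [w'r|] := leP `|w' - w| (r / 2); first exact: w0min.
  move=> w'r; apply: le_trans zw0 _; apply: le_trans (norm_le_enorm _).
  have := ler_normD (w + t *: v - w') (- (t *: v)).
  have -> : w + t *: v - w' - t *: v = w - w' by rewrite addrAC addrK.
  rewrite normrN normrZ gtr0_norm// distrC => tri.
  by rewrite mulrDr in tr; lra.
have w0w : `|w0 - w| < d.
  apply: le_lt_trans td; rewrite -(subrK (w + t *: v) w0) -addrA zw.
  rewrite (le_trans (ler_normD _ _))// mulrDr normrZ (gtr0_norm t0) lerD2r.
  by rewrite distrC (le_trans (norm_le_enorm _)).
(* minimality, then regularity: |w0 - w|^2 <= 2 t (ev / 3) |w0 - w| *)
have w0v : `|w0 - w| <= t * (ev / 3) *+ 2.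
  have [->|w0w0] := eqVneq `|w0 - w| 0.
    by rewrite mulrn_wge0// mulr_ge0// ltW.
  have vw0 : dot v (w0 - w) <= ev / 3 * `|w0 - w|.
    by apply: vd Ow0; rewrite /ball_ /= distrC.
  have := w0min _ Dw; rewrite le_enorm zw.
  have -> : w + t *: v - w0 = t *: v - (w0 - w) by rewrite opprB addrA (addrC w).
  rewrite dot_sqrB (dotZl t v (w0 - w)) => dd.
  have := sqr_norm_le_dot (w0 - w); rewrite expr2 => nd.
  have {}dd : `|w0 - w| * `|w0 - w| <= t * dot v (w0 - w) *+ 2.
    by rewrite mulr2n; lra.
  have w0p : 0 < `|w0 - w| by rewrite lt_def w0w0 /=.
  rewrite -(ler_pM2r w0p) (le_trans dd)//.
  by rewrite mulrnAl ler_pMn2r// -mulrA ler_pM2l.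
exists (w + t *: v, t^-1 *: (w + t *: v - w0)); split.
  by exists t^-1, (w + t *: v - w0); split; [rewrite invr_ge0 ltW | exists w0 |].
apply: UVB; split; [apply: Uw | apply: Vv]; rewrite /ball_ /= distrC.
  by rewrite zw normrZ gtr0_norm.
have -> : t^-1 *: (w + t *: v - w0) - v = - (t^-1 *: (w0 - w)).
  apply: (scalerI (lt0r_neq0 t0)); rewrite scalerBr scalerN !scalerA divff ?lt0r_neq0//.
  by rewrite !scale1r addrAC addrK opprB.
rewrite normrN normrZ gtr0_norm ?invr_gt0// ltr_pdivrMl//.
by apply: le_lt_trans w0v _; rewrite -mulrnAr ltr_pM2l// mulr2n; lra.
Unshelve. all: by end_near. Qed.

(** Local closedness is inherited by the nearby points, and the closure of the
    proximal normals is closed: no diagonal sequence is extracted. *)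
Lemma closure_regular_normal_cone s (Omega : set 'rV[R]_s) z v :
  locally_closed Omega z -> Omega z -> closure (regular_normals Omega) (z, v) ->
  normal_cone Omega z v.
Proof.
move=> lc Oz cl; apply/normal_coneE; split=> //.
apply: closed_closure.
have lc2 : \forall zv \near (z, v), locally_closed Omega zv.1.
  have : \forall z' \near z, locally_closed Omega z' by exact: near_join.
  exact: (@cvg_fst _ _ (nbhs z) (nbhs v)).
move=> B Bz; have [[z' v'] [[regz lcz] Bz']] := closure_near cl lc2 Bz.
by exists (z', v'); split => //; exact: regular_normal_closure_proximal.
Qed.

(** Segments issued from a point of a convex set are tangent to it, so that the
    inequality of a regular normal holds globally, and then survives limits. *)
Lemma normal_cone_convex s (Omega : set 'rV[R]_s) x v :
  closed Omega ->
  (forall a b t, Omega a -> Omega b -> 0 <= t <= 1 -> Omega (a + t *: (b - a))) ->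
  normal_cone Omega x v <-> Omega x /\ forall x', Omega x' -> dot v (x' - x) <= 0.
Proof.
move=> Ocl Oconv; split=> [xv|[Ox vx]]; last first.
  apply: closure_regular_normal_cone => //; first exact: closed_locally_closed.
  apply: subset_closure; split=> //= e e0; near=> w' => Ow'.
  by rewrite (le_trans (vx _ Ow'))// mulr_ge0// ltW.
split=> [|x' Ox']; first by have [] := xv.
have cl := normal_cone_closure_regular xv.
apply: (@closure_le R _ _ (fun zv : 'rV[R]_s * 'rV[R]_s => dot zv.2 (x' - zv.1))
  (fun=> 0) _ cl).
- apply: cvg_dot; first exact: cvg_snd.
  by apply: cvg_subrmx; [exact: cvg_const | exact: cvg_fst].
- exact: cvg_const.
near=> zv => zvreg; have [Oz _] := zvreg.
apply: (regular_normal_tangent zvreg (c := fun t => zv.1 + t *: (x' - zv.1))).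
  near=> t; apply: Oconv => //; apply/andP; split.
    by apply: ltW; near: t; exact: nbhs_right_gt.
  by near: t; exact: nbhs_right_le.
have : (fun=> x' - zv.1) @ (0 : R)^'+ --> x' - zv.1 by exact: cvg_const.
apply: cvg_trans; apply: near_eq_cvg.
near=> t; rewrite [zv.1 + _ - _]addrAC subrr add0r scalerA mulVf ?scale1r//.
Unshelve. all: by end_near. Qed.

End RegularNormals.

(** * Farkas' lemma and normals to polyhedra *)

Section Farkas.
Variable R : realType.

(** Induction on the generators.  If a separating vector [d] for the tail fails
    on the head, both the tail and the target are projected along the head onto
    the kernel of [d], and a separating vector for the projected family is
    corrected by a multiple of [d]. *)
Lemma farkas n (I : eqType) (r : seq I) (a : I -> 'rV[R]_n) (v : 'rV[R]_n) :
  uniq r ->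
  (exists p : I -> R, (forall i, 0 <= p i) /\ v = \sum_(i <- r) p i *: a i) \/
  (exists d, (forall i, i \in r -> dot (a i) d <= 0) /\ 0 < dot v d).
Proof.
elim: r a v => [|i0 r IH] a v /=.
  move=> _; have [->|v0] := eqVneq v 0.
    by left; exists (fun=> 0); rewrite big_nil.
  right; exists v; split=> //; rewrite ltNge; apply: contra v0 => /dot_self_eq0 ->.
  by [].
case/andP=> i0r ur.
have ext (p : I -> R) c (b : I -> 'rV[R]_n) :
    \sum_(i <- i0 :: r) (if i == i0 then c else p i) *: b i =
    c *: b i0 + \sum_(i <- r) p i *: b i.
  rewrite big_cons eqxx; congr (_ + _); apply: eq_big_seq => i ir.
  by case: eqP => // ii0; rewrite -ii0 ir in i0r.
have [[p [p0 ->]]|[d [ad vd]]] := IH a v ur.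
  left; exists (fun i => if i == i0 then 0 else p i).
  by split=> [i|]; [case: ifP | rewrite ext scale0r add0r].
have [a0d|a0d] := leP (dot (a i0) d) 0.
  right; exists d; split=> // i; rewrite inE => /predU1P[->//|]; exact: ad.
pose D := dot (a i0) d.
have [[p [p0 vE]]|[e [ae ve]]] :=
    IH (fun i => D *: a i - dot (a i) d *: a i0) (D *: v - dot v d *: a i0) ur.
  left; exists (fun i => if i == i0 then
    D^-1 * (dot v d - \sum_(i <- r) p i * dot (a i) d) else p i); split.
    move=> i; case: ifP => // _; rewrite mulr_ge0 ?invr_ge0 ?(ltW a0d)// subr_ge0.
    apply: le_trans (ltW vd); rewrite big_seq sumr_le0// => j jr.
    by rewrite mulr_ge0_le0// ad.
  rewrite ext; apply: (scalerI (lt0r_neq0 a0d)).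
  have -> : D *: v = (D *: v - dot v d *: a i0) + dot v d *: a i0 by rewrite subrK.
  rewrite vE.
  have -> : \sum_(i <- r) p i *: (D *: a i - dot (a i) d *: a i0) =
      D *: (\sum_(i <- r) p i *: a i) - (\sum_(i <- r) p i * dot (a i) d) *: a i0.
    rewrite scaler_sumr scaler_suml -sumrB; apply: eq_bigr => i _.
    by rewrite scalerBr !scalerA (mulrC D).
  rewrite scalerDr scalerA mulrA divff ?lt0r_neq0// mul1r scalerBl.
  by rewrite -addrA addrC [- _ + _]addrC.
right; exists (D *: e - dot (a i0) e *: d); split; last first.
  by move: ve; rewrite dotBl dotBr !dotZl !dotZr (mulrC (dot v d)).
move=> i; rewrite inE => /predU1P[->|ir].
  by rewrite dotBr !dotZr mulrC subrr.
by move: (ae i ir); rewrite dotBl dotBr !dotZl !dotZr (mulrC (dot (a i) d)).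
Qed.

End Farkas.

Section Polyhedra.
Variable R : realType.

Lemma polyhedron_closed m n (A : 'M[R]_(m, n)) b : closed (polyhedron A b).
Proof.
move=> x xcl i; have := @closure_le _ _ _ (fun x : 'rV[R]_n => dot (row i A) x)
  (fun=> b 0 i) _ xcl; apply.
- by apply: cvg_dot => //; exact: cvg_const.
- exact: cvg_const.
- by near=> t; apply.
Unshelve. all: by end_near. Qed.

Lemma polyhedron_convex m n (A : 'M[R]_(m, n)) b x y t :
  polyhedron A b x -> polyhedron A b y -> 0 <= t <= 1 ->
  polyhedron A b (x + t *: (y - x)).
Proof.
move=> Px Py /andP[t0 t1] i; rewrite dotDr dotZr dotBr.
have := Px i; have := Py i; nra.
Qed.

Lemma orthant_polyhedron m : orthant_nonpos = polyhedron (1%:M : 'M[R]_m) 0.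
Proof.
apply/seteqP; split=> x xP i; have := xP i;
  by rewrite -row_mul_tr trmx1 mulmx1 mxE.
Qed.

Lemma normal_cone_orthantE m (s p : 'rV[R]_m) :
  normal_cone orthant_nonpos s p <->
  forall i, [/\ s 0 i <= 0, 0 <= p 0 i & s 0 i * p 0 i = 0].
Proof.
rewrite normal_cone_convex; first last.
- by rewrite orthant_polyhedron => a b t; exact: polyhedron_convex.
- by rewrite orthant_polyhedron; exact: polyhedron_closed.
split=> [[Os ps] i|sp]; last first.
  split=> [i|s' Os']; first by have [] := sp i.
  by apply: sumr_le0 => i _; rewrite !mxE; have [s0 p0 sp0] := sp i;
    have := Os' i; nra.
have p0 : 0 <= p 0 i.
  have := ps (s - delta_mx 0 i); rewrite [_ - _ - _]addrAC subrr add0r dotNr dot_deltar oppr_le0.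
  by apply=> j; rewrite !mxE subr_le0 (le_trans (Os j)).
split=> //; apply/eqP; rewrite eq_le mulr_le0_ge0//=.
have := ps (s - s 0 i *: delta_mx 0 i); rewrite [_ - _ - _]addrAC subrr add0r dotNr dotZr dot_deltar.
rewrite oppr_le0; apply=> j; rewrite !mxE eqxx/=.
by case: eqP => [->|_]; rewrite ?mulr1 ?subrr// mulr0 subr0 Os.
Qed.

Lemma multipliersE m n (x : 'rV[R]_n) (A : 'M[R]_(m, n)) b v p :
  multipliers x A b v p <->
  (forall i, [/\ dot (row i A) x <= b 0 i, 0 <= p 0 i &
                 (dot (row i A) x - b 0 i) * p 0 i = 0]) /\ p *m A = v.
Proof.
rewrite /multipliers/= normal_cone_orthantE.
split=> -[sp <-]; split=> // i; have [] := sp i;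
  by rewrite mxE row_mul_tr [(- b) _ _]mxE subr_le0.
Qed.

(** By Farkas' lemma, normals to a polyhedron are the nonnegative combinations
    of the active rows. *)
Lemma G_multipliers m n (x : 'rV[R]_n) (A : 'M[R]_(m, n)) b v :
  G x A b v <-> exists p, multipliers x A b v p.
Proof.
rewrite /G normal_cone_convex; first last.
- by move=> *; exact: polyhedron_convex.
- exact: polyhedron_closed.
split=> [[Px vx]|[p /multipliersE[pP <-]]]; last first.
  split=> [i|x' Px']; first by have [] := pP i.
  rewrite dot_mulmxl; apply: sumr_le0 => i _; rewrite row_mul_tr dotBr.
  by have [] := pP i; have := Px' i; nra.
have [[p [p0 vE]]|[d [ad vd]]] :=
    farkas (fun i => row i A) v (enum_uniq (active x A b)).
  exists (\row_i (if i \in active x A b then p i else 0)).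
  apply/multipliersE; split=> [i|].
    rewrite mxE; split; [exact: Px | by case: ifP|].
    by rewrite inE; case: eqP => [->|]; rewrite ?subrr ?mul0r// mulr0.
  rewrite vE big_enum /= [RHS]big_mkcond mulmx_sum_row.
  by apply: eq_bigr => i _; rewrite mxE; case: ifP => //; rewrite scale0r.
(* the inactive constraints tolerate a small step along [d] *)
have : \forall t \near (0 : R)^'+, polyhedron A b (x + t *: d).
  rewrite /polyhedron /=.
  apply: filter_forall => i; have [ia|ia] := boolP (i \in active x A b).
    near=> t; have t0 : 0 < t by near: t; exact: nbhs_right_gt.
    rewrite dotDr dotZr -[leRHS]addr0 lerD// ?mulr_ge0_le0// ?(ltW t0)//.
    by apply: ad; rewrite mem_enum.
  have bx : 0 < b 0 i - dot (row i A) x.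
    by rewrite subr_gt0 lt_neqAle Px andbT; rewrite inE in ia.
  near=> t; rewrite dotDr dotZr -lerBrDl ltW//.
  by near: t; exact: near_right_mul_lt.
move=> Pt; exfalso; near (0 : R)^'+ => t.
have t0 : 0 < t by near: t; exact: nbhs_right_gt.
have /vx : polyhedron A b (x + t *: d) by near: t.
by rewrite addrAC subrr add0r dotZr leNgt mulr_gt0.
Unshelve. all: by end_near. Qed.

End Polyhedra.

(** * Normals to the graph of the normal cone mapping of the orthant *)

Section OrthantGraph.
Variables (R : realType) (m : nat).
Implicit Types s p q h : 'rV[R]_m.

Local Notation N := (@normal_cone R m orthant_nonpos).
Local Notation Gamma := (graph N).
Local Notation quadruple := (('rV[R]_m * 'rV[R]_m) * ('rV[R]_m * 'rV[R]_m))%type.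

Lemma graph_row_mx k (S : 'rV[R]_m -> set 'rV[R]_k) s (p : 'rV[R]_k) :
  graph S (row_mx s p) = S s p.
Proof. by rewrite /graph/= row_mxKl row_mxKr. Qed.

Lemma closure_graph_orthant (T : topologicalType) (K : set T)
    (s p : T -> 'rV[R]_m) z :
  closure K z -> s @ z --> s z -> p @ z --> p z ->
  (\forall t \near z, K t -> N (s t) (p t)) -> N (s z) (p z).
Proof.
move=> Kz sz pz KN; apply/normal_cone_orthantE => i.
have si : (fun t => s t 0 i) @ z --> s z 0 i by exact: cvg_entry.
have pi : (fun t => p t 0 i) @ z --> p z 0 i by exact: cvg_entry.
split.
- have := closure_le (f := fun t => s t 0 i) (g := fun=> 0) Kz si; apply.
    exact: cvg_const.
  by apply: filterS KN => t KN /KN /normal_cone_orthantE/(_ i)[].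
- have := closure_le (f := fun=> 0) (g := fun t => p t 0 i) Kz _ pi; apply.
    exact: cvg_const.
  by apply: filterS KN => t KN /KN /normal_cone_orthantE/(_ i)[].
- have := closure_eq (f := fun t => s t 0 i * p t 0 i) (g := fun=> 0) Kz; apply.
  + exact: cvgM.
  + exact: cvg_const.
  + by apply: filterS KN => t KN /KN /normal_cone_orthantE/(_ i)[].
Qed.

Lemma graph_orthant_closed : closed Gamma.
Proof.
move=> z zcl; apply: (closure_graph_orthant zcl).
- exact: cvg_lsubmx.
- exact: cvg_rsubmx.
- by near=> t.
Unshelve. all: by end_near. Qed.

(** Coordinates of the polar of the tangent cone to the graph at [(s, p)], for
    the vector [(q, - h)]; the sign of [h] is that of a coderivative. *)
Definition compl_normal s p q h : Prop :=
  forall i, [/\ s 0 i < 0 -> q 0 i = 0, 0 < p 0 i -> h 0 i = 0 &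
             s 0 i = 0 -> p 0 i = 0 -> 0 <= q 0 i /\ 0 <= h 0 i].

(** The graph is locally a union of polyhedral cones, so that testing against
    straight tangent directions is enough. *)
Lemma compl_normal_tangent s p q h :
  N s p ->
  (forall s' p', (\forall t \near (0 : R)^'+, N (s + t *: s') (p + t *: p')) ->
     dot q s' <= dot h p') ->
  compl_normal s p q h.
Proof.
move=> /normal_cone_orthantE Nsp qh i; have [s0 p0 sp0] := Nsp i.
have test (a c : R) : (\forall t \near (0 : R)^'+,
    [/\ s 0 i + t * a <= 0, 0 <= p 0 i + t * c
       & (s 0 i + t * a) * (p 0 i + t * c) = 0]) -> a * q 0 i <= c * h 0 i.
  move=> ac; have := qh (a *: delta_mx 0 i) (c *: delta_mx 0 i).
  rewrite !dotZr !dot_deltar; apply; near=> t; apply/normal_cone_orthantE => j.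
  rewrite !mxE eqxx /=; have [->|ji] := eqVneq j i; rewrite ?mulr1 ?mulr0 ?addr0.
    by near: t.
  exact: Nsp.
split.
- move=> si; have pi : p 0 i = 0.
    by move/eqP: sp0; rewrite mulf_eq0 (lt_eqF si) => /eqP.
  have si' : 0 < - s 0 i by rewrite oppr_gt0.
  have : 1 * q 0 i <= 0 * h 0 i.
    apply: test; near=> t; rewrite mulr0 addr0 pi !mulr0; split=> //.
    by rewrite -lerBrDl sub0r ltW//; near: t; exact: near_right_mul_lt.
  have : -1 * q 0 i <= 0 * h 0 i.
    apply: test; near=> t; rewrite mulr0 addr0 pi !mulr0; split=> //.
    by rewrite mulrN1 subr_le0 (le_trans s0)// ltW.
  by lra.
- move=> pi; have si : s 0 i = 0.
    by move/eqP: sp0; rewrite mulf_eq0 (gt_eqF pi) orbF => /eqP.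
  have : 0 * q 0 i <= -1 * h 0 i.
    apply: test; near=> t; rewrite mulr0 addr0 si !mul0r; split=> //.
    by rewrite mulrN subr_ge0 ltW//; near: t; exact: near_right_mul_lt.
  have : 0 * q 0 i <= 1 * h 0 i.
    apply: test; near=> t; rewrite mulr0 addr0 si !mul0r; split=> //.
    by rewrite mulr1 addr_ge0// ltW.
  by lra.
- move=> si pi; split.
    have : -1 * q 0 i <= 0 * h 0 i.
      apply: test; near=> t; rewrite mulr0 addr0 pi !mulr0; split=> //.
      by rewrite mulrN1 subr_le0 (le_trans s0)// ltW.
    by lra.
  have : 0 * q 0 i <= 1 * h 0 i.
    apply: test; near=> t; rewrite mulr0 addr0 si !mul0r; split=> //.
    by rewrite mulr1 addr_ge0// ltW.
  by lra.
Unshelve. all: by end_near. Qed.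

(** A branch of the graph is left only by crossing the corner, so that near
    [(s, p)] displacements are tangent directions and no remainder appears. *)
Lemma compl_normal_near s p q h :
  N s p -> compl_normal s p q h ->
  exists2 d, 0 < d & forall s' p', N s' p' ->
    `|s' - s| < d -> `|p' - p| < d -> dot q (s' - s) <= dot h (p' - p).
Proof.
move=> /normal_cone_orthantE Nsp qh.
have [d d0 dP] : exists2 d : R, 0 < d &
    forall i, (s 0 i < 0 -> s 0 i + d <= 0) /\ (0 < p 0 i -> d <= p 0 i).
  have : \forall d \near (0 : R)^'+,
      forall i, (s 0 i < 0 -> s 0 i + d <= 0) /\ (0 < p 0 i -> d <= p 0 i).
    apply: filter_forall => i; apply: filterI.
      have [si|si] := ltP (s 0 i) 0; last by near=> d.
      near=> d => _; rewrite -lerBrDl sub0r ltW// -[d]mulr1; near: d.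
      by apply: near_right_mul_lt; rewrite oppr_gt0.
    have [pi|pi] := ltP 0 (p 0 i); last by near=> d.
    by near=> d => _; rewrite ltW// -[d]mulr1; near: d; exact: near_right_mul_lt.
  move=> dP; near (0 : R)^'+ => d; exists d; last by near: d.
  by near: d; exact: nbhs_right_gt.
exists d => // s' p' /normal_cone_orthantE Nsp' sd pd.
apply: ler_sum => i _; rewrite !mxE.
have [s0 p0 sp0] := Nsp i; have [s0' p0' sp0'] := Nsp' i.
have [qi hi qhi] := qh i; have [sdi pdi] := dP i.
have := le_lt_trans (coord_le_norm (s' - s) 0 i) sd.
have := le_lt_trans (coord_le_norm (p' - p) 0 i) pd.
rewrite !mxE => /ltr_normlP[pd1 pd2] /ltr_normlP[sd1 sd2].
have [si|si] := ltP (s 0 i) 0.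
  have pi : p 0 i = 0 by move/eqP: sp0; rewrite mulf_eq0 (lt_eqF si) => /eqP.
  have si' : s' 0 i < 0 by have := sdi si; lra.
  have pi' : p' 0 i = 0 by move/eqP: sp0'; rewrite mulf_eq0 (lt_eqF si') => /eqP.
  by rewrite qi// pi pi' mul0r subrr mulr0.
have {}si : s 0 i = 0 by apply/eqP; rewrite eq_le s0.
have [pi|pi] := ltP 0 (p 0 i).
  have pi' : 0 < p' 0 i by have := pdi pi; lra.
  have si' : s' 0 i = 0.
    by move/eqP: sp0'; rewrite mulf_eq0 (gt_eqF pi') orbF => /eqP.
  by rewrite hi// si si' mul0r subrr mulr0.
have {}pi : p 0 i = 0 by apply/eqP; rewrite eq_le pi.
have [q0 h0] := qhi si pi.
by rewrite si pi !subr0 (@le_trans _ _ 0)// ?mulr_ge0// mulr_ge0_le0.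
Unshelve. all: by end_near. Qed.

Lemma regular_normal_orthant s p q h :
  regular_normal Gamma (row_mx s p) (row_mx q (- h)) <->
  N s p /\ compl_normal s p q h.
Proof.
split=> [reg|[Nsp cn]].
  have Nsp : N s p by have [+ _] := reg; rewrite graph_row_mx.
  split=> //; apply: compl_normal_tangent => // s' p' Nt.
  have := regular_normal_tangent reg
    (c := fun t => row_mx (s + t *: s') (p + t *: p')) (e := row_mx s' p').
  rewrite dot_row_mx dotNl subr_le0; apply.
    by apply: filterS Nt => t; rewrite graph_row_mx.
  have : (fun=> row_mx s' p') @ (0 : R)^'+ --> row_mx s' p' by exact: cvg_const.
  apply: cvg_trans; apply: near_eq_cvg; near=> t.
  rewrite opp_row_mx add_row_mx [s + _ - _]addrAC [p + _ - _]addrAC !subrr !add0r.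
  by rewrite -scale_row_mx scalerA mulVf ?scale1r.
split; first by rewrite graph_row_mx.
move=> e e0; have [d d0 dP] := compl_normal_near Nsp cn.
near=> z' => Gz'.
have zd : `|z' - row_mx s p| < d by near: z'; exact: near_norm_lt.
have zE : z' - row_mx s p = row_mx (lsubmx z' - s) (rsubmx z' - p).
  by rewrite -{1}(hsubmxK z') opp_row_mx add_row_mx.
rewrite zE dot_row_mx dotNl -zE (@le_trans _ _ 0)//; last first.
  by rewrite mulr_ge0// ltW.
rewrite subr_le0 dP//; rewrite (le_lt_trans _ zd)// zE.
  exact: norm_row_mx_l.
exact: norm_row_mx_r.
Unshelve. all: by end_near. Qed.

Lemma normal_cone_graph_orthant s p q h :
  normal_cone Gamma (row_mx s p) (row_mx q (- h)) <->
  N s p /\ closure [set z : quadruple |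
    N z.1.1 z.1.2 /\ compl_normal z.1.1 z.1.2 z.2.1 z.2.2] ((s, p), (q, h)).
Proof.
split=> [nc|[Nsp cl]].
  split; first by have [+ _] := nc; rewrite graph_row_mx.
  have cl := normal_cone_closure_regular nc.
  pose f (zv : 'rV[R]_(m + m) * 'rV[R]_(m + m)) :=
    ((lsubmx zv.1, rsubmx zv.1), (lsubmx zv.2, - rsubmx zv.2)).
  have -> : ((s, p), (q, h)) = f (row_mx s p, row_mx q (- h)).
    by rewrite /f /= !row_mxKl !row_mxKr opprK.
  apply: (closure_map cl).
    apply: cvg_to_pair; apply: cvg_to_pair.
    - by apply: cvg_lsubmx; exact: cvg_to_fst.
    - by apply: cvg_rsubmx; exact: cvg_to_fst.
    - by apply: cvg_lsubmx; exact: cvg_to_snd.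
    - by apply: cvg_oppmx; apply: cvg_rsubmx; exact: cvg_to_snd.
  near=> zv => zvr; apply/regular_normal_orthant.
  by rewrite opprK !hsubmxK.
apply: closure_regular_normal_cone.
- exact: closed_locally_closed graph_orthant_closed.
- by rewrite graph_row_mx.
apply: (closure_map (f := fun z : quadruple =>
    (row_mx z.1.1 z.1.2, row_mx z.2.1 (- z.2.2))) cl).
  apply: cvg_to_pair; apply: cvg_row_mx.
  - by apply: cvg_to_fst; exact: cvg_to_fst.
  - by apply: cvg_to_snd; exact: cvg_to_fst.
  - by apply: cvg_to_fst; exact: cvg_to_snd.
  - by apply: cvg_oppmx; apply: cvg_to_snd; exact: cvg_to_snd.
by near=> z => Nz; apply/regular_normal_orthant.
Unshelve. all: by end_near. Qed.

(** A regular normal has q_i = 0 where s_i < 0 and h_i = 0 where p_i > 0, so that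
    a nonzero h_i excludes points with p_i > 0 nearby; at the corner both q_i and
    h_i are nonnegative.  The resulting implications survive limits. *)
Lemma normal_cone_graph_orthant_sign s p q h i :
  normal_cone Gamma (row_mx s p) (row_mx q (- h)) ->
  [/\ s 0 i < 0 -> q 0 i = 0, h 0 i < 0 -> q 0 i = 0 & 0 < h 0 i -> 0 <= q 0 i].
Proof.
move=> /normal_cone_graph_orthant[_ cl]; set z0 := ((s, p), (q, h)) in cl.
have c1 : (fun z : quadruple => z.1.1 0 i) @
    z0 --> z0.1.1 0 i.
  by apply: cvg_entry; apply: cvg_to_fst; exact: cvg_to_fst.
have c2 : (fun z : quadruple => z.2.1 0 i) @
    z0 --> z0.2.1 0 i.
  by apply: cvg_entry; apply: cvg_to_fst; exact: cvg_to_snd.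
have c3 : (fun z : quadruple => z.2.2 0 i) @
    z0 --> z0.2.2 0 i.
  by apply: cvg_entry; apply: cvg_to_snd; exact: cvg_to_snd.
have q0 (z : quadruple) : N z.1.1 z.1.2 /\ compl_normal z.1.1 z.1.2 z.2.1 z.2.2 ->
    (z.2.2 0 i < 0 -> z.2.1 0 i = 0) /\ (0 < z.2.2 0 i -> 0 <= z.2.1 0 i).
  case=> /normal_cone_orthantE/(_ i)[s0 p0 sp0] /(_ i)[qs hp qh].
  have [si|si] := ltP (z.1.1 0 i) 0; first by rewrite qs.
  have {}si : z.1.1 0 i = 0 by apply/eqP; rewrite eq_le s0.
  have [pi|pi] := ltP 0 (z.1.2 0 i); first by rewrite hp// ltxx.
  have {}pi : z.1.2 0 i = 0 by apply/eqP; rewrite eq_le pi.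
  by have [qi hi] := qh si pi; rewrite ltNge hi.
split=> [si|hi|hi].
- have := closure_eq (f := fun z : quadruple => z.2.1 0 i) (g := fun=> 0) cl c2; apply.
    exact: cvg_const.
  near=> z => -[_ /(_ i)[+ _ _]].
  by apply; near: z; exact: (cvgr_lt _ c1).
- have := closure_eq (f := fun z : quadruple => z.2.1 0 i) (g := fun=> 0) cl c2; apply.
    exact: cvg_const.
  near=> z => /q0[+ _]; apply.
  by near: z; exact: (cvgr_lt _ c3).
- have := closure_le (f := fun=> 0) (g := fun z : quadruple => z.2.1 0 i) cl _ c2; apply.
    exact: cvg_const.
  near=> z => /q0[_]; apply.
  by near: z; exact: (cvgr_gt _ c3).
Unshelve. all: by end_near. Qed.

End OrthantGraph.

(** * The graph of F and its multipliers *)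

Section Points.
Variables (R : realType) (n m d : nat).
Implicit Types (x w : 'rV[R]_n) (A : 'M[R]_(m, n)) (b : 'rV[R]_m) (u : 'rV[R]_d).
Local Notation point_type := ('rV[R]_(n + m * n + m + d + n)).
Implicit Types (z : point_type).

Definition gpoint x A b u w : point_type := row_mx (pack x A b u) w.
Definition x_of z : 'rV[R]_n := lsubmx (lsubmx (lsubmx (lsubmx z))).
Definition A_of z : 'M[R]_(m, n) := vec_mx (rsubmx (lsubmx (lsubmx (lsubmx z)))).
Definition b_of z : 'rV[R]_m := rsubmx (lsubmx (lsubmx z)).
Definition u_of z : 'rV[R]_d := rsubmx (lsubmx z).
Definition w_of z : 'rV[R]_n := rsubmx z.

Lemma x_of_gpoint x A b u w : x_of (gpoint x A b u w) = x.
Proof. by rewrite /x_of /gpoint /pack !row_mxKl. Qed.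

Lemma A_of_gpoint x A b u w : A_of (gpoint x A b u w) = A.
Proof. by rewrite /A_of /gpoint /pack !row_mxKl row_mxKr mxvecK. Qed.

Lemma b_of_gpoint x A b u w : b_of (gpoint x A b u w) = b.
Proof. by rewrite /b_of /gpoint /pack !row_mxKl row_mxKr. Qed.

Lemma u_of_gpoint x A b u w : u_of (gpoint x A b u w) = u.
Proof. by rewrite /u_of /gpoint /pack row_mxKl row_mxKr. Qed.

Lemma w_of_gpoint x A b u w : w_of (gpoint x A b u w) = w.
Proof. by rewrite /w_of /gpoint row_mxKr. Qed.

Definition of_gpointE := (x_of_gpoint, A_of_gpoint, b_of_gpoint, u_of_gpoint, w_of_gpoint).

Lemma gpointK z : gpoint (x_of z) (A_of z) (b_of z) (u_of z) (w_of z) = z.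
Proof. by rewrite /gpoint /pack vec_mxK !hsubmxK. Qed.

Lemma dot_gpoint x A b u w x' A' b' u' w' :
  dot (gpoint x A b u w) (gpoint x' A' b' u' w') =
  dot x x' + dot (mxvec A) (mxvec A') + dot b b' + dot u u' + dot w w'.
Proof. by rewrite !dot_row_mx. Qed.

Lemma sub_gpoint x A b u w x' A' b' u' w' :
  gpoint x A b u w - gpoint x' A' b' u' w' =
  gpoint (x - x') (A - A') (b - b') (u - u') (w - w').
Proof. by rewrite /gpoint /pack !(opp_row_mx, add_row_mx) linearB. Qed.

Lemma scale_gpoint t x A b u w :
  t *: gpoint x A b u w = gpoint (t *: x) (t *: A) (t *: b) (t *: u) (t *: w).
Proof. by rewrite /gpoint /pack !scale_row_mx linearZ. Qed.

Lemma norm_x_gpoint x A b u w : `|x| <= `|gpoint x A b u w|.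
Proof. by do 4 (apply: le_trans (norm_row_mx_l _ _)). Qed.

Lemma norm_A_gpoint x A b u w : `|A| <= `|gpoint x A b u w|.
Proof.
do 3 (apply: le_trans (norm_row_mx_l _ _)).
exact: le_trans (norm_mxvec _) (norm_row_mx_r _ _).
Qed.

Lemma norm_u_gpoint x A b u w : `|u| <= `|gpoint x A b u w|.
Proof. apply: le_trans (norm_row_mx_l _ _); exact: norm_row_mx_r. Qed.

Section Convergence.
Context {T : Type} {Fi : set_system T} {FF : Filter Fi}.
Local Notation "f @@ F --> l" := (cvg_to (fmap f F) (nbhs l))
  (at level 70, F at next level).

Lemma cvg_gpoint (fx : T -> 'rV[R]_n) (fA : T -> 'M[R]_(m, n)) (fb : T -> 'rV[R]_m)
    (fu : T -> 'rV[R]_d) (fw : T -> 'rV[R]_n) x A b u w :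
  fx @@ Fi --> x -> fA @@ Fi --> A -> fb @@ Fi --> b -> fu @@ Fi --> u ->
  fw @@ Fi --> w ->
  (fun t => gpoint (fx t) (fA t) (fb t) (fu t) (fw t)) @@ Fi --> gpoint x A b u w.
Proof.
move=> xc Ac bc uc wc; do 4 (apply: cvg_row_mx => //); exact: cvg_mxvec.
Qed.

Lemma cvg_x_of (f : T -> point_type) z :
  f @@ Fi --> z -> (fun t => x_of (f t)) @@ Fi --> x_of z.
Proof. by move=> fz; do 4 apply: cvg_lsubmx. Qed.

Lemma cvg_A_of (f : T -> point_type) z :
  f @@ Fi --> z -> (fun t => A_of (f t)) @@ Fi --> A_of z.
Proof. by move=> fz; apply: cvg_vec_mx; apply: cvg_rsubmx; do 3 apply: cvg_lsubmx. Qed.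

Lemma cvg_b_of (f : T -> point_type) z :
  f @@ Fi --> z -> (fun t => b_of (f t)) @@ Fi --> b_of z.
Proof. by move=> fz; apply: cvg_rsubmx; do 2 apply: cvg_lsubmx. Qed.

Lemma cvg_u_of (f : T -> point_type) z :
  f @@ Fi --> z -> (fun t => u_of (f t)) @@ Fi --> u_of z.
Proof. by move=> fz; apply: cvg_rsubmx; apply: cvg_lsubmx. Qed.

Lemma cvg_w_of (f : T -> point_type) z :
  f @@ Fi --> z -> (fun t => w_of (f t)) @@ Fi --> w_of z.
Proof. by move=> fz; apply: cvg_rsubmx. Qed.

Lemma cvg_xu_of (f : T -> point_type) z :
  f @@ Fi --> z -> (fun t => (x_of (f t), u_of (f t))) @@ Fi --> (x_of z, u_of z).
Proof. by move=> fz; apply: cvg_to_pair; [exact: cvg_x_of | exact: cvg_u_of]. Qed.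

Lemma cvg_slack (f : T -> point_type) z :
  f @@ Fi --> z ->
  (fun t => x_of (f t) *m (A_of (f t))^T - b_of (f t)) @@ Fi -->
    x_of z *m (A_of z)^T - b_of z.
Proof.
move=> fz; apply: cvg_subrmx; last exact: cvg_b_of.
by apply: cvg_mulmx; [exact: cvg_x_of | apply: cvg_trmx; exact: cvg_A_of].
Qed.

End Convergence.

End Points.

Section Multipliers.
Variables (R : realType) (n m d : nat) (g : 'rV[R]_n * 'rV[R]_d -> 'rV[R]_n).
Local Notation point_type := ('rV[R]_(n + m * n + m + d + n)).
Local Notation Omega := (graph (unpacked (F (m := m) g))).

Definition multipliers_at (z : point_type) : set 'rV[R]_m :=
  multipliers (x_of z) (A_of z) (b_of z) (w_of z + g (x_of z, u_of z)).

Lemma graph_F_multipliers z : Omega z <-> exists p, multipliers_at z p.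
Proof.
rewrite -G_multipliers; split=> [[v Gv vw]|Gw].
  by rewrite /w_of -vw subrK.
by exists (w_of z + g (x_of z, u_of z)) => //; rewrite addrK.
Qed.

Lemma multipliers_at_closure (T : topologicalType) (K : set T)
    (z : T -> point_type) (p : T -> 'rV[R]_m) t :
  closure K t -> z @ t --> z t -> p @ t --> p t ->
  {for (x_of (z t), u_of (z t)), continuous g} ->
  (\forall t' \near t, K t' -> multipliers_at (z t') (p t')) ->
  multipliers_at (z t) (p t).
Proof.
move=> Kt zt pt gc KM; split.
  apply: (closure_graph_orthant (s := fun t => x_of (z t) *m (A_of (z t))^T - b_of (z t)) Kt _ pt).
    exact: cvg_slack.
  by apply: filterS KM => t' + Kt' => /(_ Kt')[].
have := closure_eq_mx (f := fun t => p t *m A_of (z t))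
  (g := fun t => w_of (z t) + g (x_of (z t), u_of (z t))) Kt; apply.
- by apply: cvg_mulmx => //; exact: cvg_A_of.
- apply: cvg_addmx; first exact: cvg_w_of.
  exact: cvg_comp (cvg_xu_of zt) gc.
by apply: filterS KM => t' + Kt' => /(_ Kt')[].
Qed.

Definition supported (I : {set 'I_m}) (p : 'rV[R]_m) : Prop :=
  forall i, i \notin I -> p 0 i = 0.

(** Positive linear independence is quantitative: by compactness of the unit
    sphere of multipliers, [p |-> p *m A] is bounded below. *)
Lemma pos_lin_indep_bound (I : {set 'I_m}) (A : 'M[R]_(m, n)) :
  pos_lin_indep I A ->
  exists2 c, 0 < c & forall p : 'rV[R]_m, (forall i, 0 <= p 0 i) ->
    supported I p -> c * `|p| <= `|p *m A|.
Proof.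
move=> pli.
pose S := [set p : 'rV[R]_m | [/\ `|p| = 1, forall i, 0 <= p 0 i & supported I p]].
have normS (p : 'rV[R]_m) : (forall i, 0 <= p 0 i) -> supported I p -> p != 0 -> S (`|p|^-1 *: p).
  move=> p0 pI pn0; have np : 0 < `|p| by rewrite normr_gt0.
  split=> [|i|i iI]; first by rewrite normrZ ger0_norm ?invr_ge0// mulVf ?gt_eqF.
    by rewrite mxE mulr_ge0 ?invr_ge0.
  by rewrite mxE pI// mulr0.
have [S0|/set0P/negP/negPn/eqP S0] := pselect (S !=set0); last first.
  exists 1 => // p p0 pI; rewrite mul1r.
  have [->|pn0] := eqVneq p 0; first by rewrite normr0.
  by have := normS p p0 pI pn0; rewrite S0.
have Scl : closed S.
  move=> p pcl; split.
  - have := closure_eq (f := fun p : 'rV[R]_m => `|p|) (g := fun=> 1) pcl; apply.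
    + exact: cvg_normmx.
    + exact: cvg_const.
    + by near=> q => -[].
  - move=> i; have := closure_le (f := fun=> 0) (g := fun p : 'rV[R]_m => p 0 i) pcl.
    apply.
    + exact: cvg_const.
    + exact: cvg_entry.
    + by near=> q => -[].
  - move=> i iI; have := closure_eq (f := fun p : 'rV[R]_m => p 0 i) (g := fun=> 0) pcl.
    apply.
    + exact: cvg_entry.
    + exact: cvg_const.
    + by near=> q => -[_ _]; apply.
have Sc : compact S.
  apply: (subclosed_compact Scl (@closed_ball_norm_compact R m 0 1)) => p [p1 _ _] /=.
  by rewrite subr0 p1.
have cont : {within S, continuous (fun p : 'rV[R]_m => `|p *m A|)}.
  apply: continuous_subspaceT => p; apply: cvg_normmx.
  by apply: cvg_mulmx => //; exact: cvg_const.
have [p0 /set_mem[p01 p0ge p0I] p0min] := EVT_min_rV S0 Sc cont.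
exists `|p0 *m A|.
  rewrite normr_gt0; apply/negP => /eqP p0A.
  have /(_ (fun i => p0 0 i)) := pli; move=> /(_ (fun i _ => p0ge i)) p0i.
  have p00 : p0 = 0.
    apply/rowP => i; rewrite mxE; have [iI|iI] := boolP (i \in I); last exact: p0I.
    apply: p0i => //; rewrite -[RHS]p0A mulmx_sum_row [LHS]big_mkcond.
    by apply: eq_bigr => j _; case: ifPn => // jI; rewrite p0I// scale0r.
  by move: p01; rewrite p00 normr0 => /esym/eqP; rewrite oner_eq0.
move=> p pge pI; have [->|pn0] := eqVneq p 0; first by rewrite normr0 mulr0.
have np : 0 < `|p| by rewrite normr_gt0.
have := p0min _ (mem_set (normS p pge pI pn0)).
by rewrite -scalemxAl normrZ ger0_norm ?invr_ge0// ler_pdivlMl// mulrC.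
Unshelve. all: by end_near. Qed.

Section NearReference.
Variables (x : 'rV[R]_n) (A : 'M[R]_(m, n)) (b : 'rV[R]_m) (u : 'rV[R]_d) (w : 'rV[R]_n).
Hypothesis hx : polyhedron A b x.

Lemma near_supported :
  \forall z \near gpoint x A b u w, forall p, multipliers_at z p ->
    supported (active x A b) p.
Proof.
have : \forall z \near gpoint x A b u w, forall i, i \notin active x A b ->
    (x_of z *m (A_of z)^T - b_of z) 0 i < 0.
  apply: (@filter_forall _ _ _ (nbhs (gpoint x A b u w))) => i.
  have [ia|ia] := boolP (i \in active x A b).
    by near=> z.
  have si : (fun z => (x_of z *m (A_of z)^T - b_of z) 0 i) @ gpoint x A b u w -->
      (x_of (gpoint x A b u w) *m (A_of (gpoint x A b u w))^T - b_of (gpoint x A b u w)) 0 i.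
    by apply: cvg_entry; exact: cvg_slack.
  near=> z => _; near: z; apply: (cvgr_lt _ si).
  rewrite !of_gpointE mxE row_mul_tr [(- b) _ _]mxE subr_lt0 lt_neqAle hx andbT.
  by rewrite inE in ia.
apply: filterS => z slack p [/normal_cone_orthantE Np _] i /slack si.
have [_ _ /eqP] := Np i; rewrite mulf_eq0 => /orP[/eqP s0|/eqP//].
by rewrite s0 ltxx in si.
Unshelve. all: by end_near. Qed.

Hypothesis hPLI : pos_lin_indep (active x A b) A.
Hypothesis gc : {for (x, u), continuous g}.

(** The lower bound on [p *m A] is stable under small changes of [A], and
    [p *m A] equals [w + g (x, u)], which is bounded nearby. *)
Lemma near_multipliers_bounded :
  exists M, \forall z \near gpoint x A b u w, forall p, multipliers_at z p -> `|p| <= M.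
Proof.
have [c c0 cP] := pos_lin_indep_bound hPLI.
pose C := `|w + g (x, u)| + 1.
exists (2 * C / c).
have Az : (fun z => m%:R * `|A_of z - A|) @ gpoint x A b u w -->
    m%:R * `|A_of (gpoint x A b u w) - A|.
  apply: cvg_mul; first exact: cvg_const.
  by apply: cvg_normmx; apply: cvg_subrmx; [exact: cvg_A_of | exact: cvg_const].
have xuz : (fun z => (x_of z, u_of z)) @ gpoint x A b u w -->
    (x_of (gpoint x A b u w), u_of (gpoint x A b u w)) by exact: cvg_xu_of.
rewrite !of_gpointE in xuz.
have wz : (fun z => `|w_of z + g (x_of z, u_of z)|) @ gpoint x A b u w -->
    `|w_of (gpoint x A b u w) + g (x, u)|.
  apply: cvg_normmx; apply: cvg_addmx; first exact: cvg_w_of.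
  exact: cvg_comp xuz gc.
rewrite of_gpointE subrr normr0 mulr0 in Az; rewrite of_gpointE in wz.
have c2 : 0 < c / 2 by rewrite divr_gt0.
near=> z => p pz; have [/normal_cone_orthantE Np pA] := pz.
have mA : m%:R * `|A_of z - A| < c / 2 by near: z; exact: (cvgr_lt _ Az).
have wC : `|w_of z + g (x_of z, u_of z)| < C.
  by near: z; apply: (cvgr_lt _ wz); rewrite ltrDl.
have pI : supported (active x A b) p by move: p pz {Np pA}; near: z; exact: near_supported.
have pge i : 0 <= p 0 i by have [] := Np i.
have := cP p pge pI; have -> : p *m A = p *m A_of z - p *m (A_of z - A).
  by rewrite mulmxBr opprB addrC subrK.
rewrite pA => h1.
have h2 := ler_normB (w_of z + g (x_of z, u_of z)) (p *m (A_of z - A)).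
have h3 := norm_mulmx_le p (A_of z - A).
have h4 : m%:R * `|A_of z - A| * `|p| <= c / 2 * `|p| by rewrite ler_wpM2r// ltW.
rewrite ler_pdivlMr//; lra.
Unshelve. all: by end_near. Qed.

(** Bounded multipliers have cluster points, and the equations that they satisfy
    are closed. *)
Lemma graph_F_locally_closed :
  (\forall xu \near (x, u), {for xu, continuous g}) ->
  locally_closed Omega (gpoint x A b u w).
Proof.
move=> gcn; have [M /near_join pM] := near_multipliers_bounded.
have xuz : (fun z => (x_of z, u_of z)) @ gpoint x A b u w -->
    (x_of (gpoint x A b u w), u_of (gpoint x A b u w)) by exact: cvg_xu_of.
rewrite !of_gpointE in xuz.
have gnear : \forall z \near gpoint x A b u w, {for (x_of z, u_of z), continuous g}.
  exact: (xuz _ gcn).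
near=> z => zcl; have gz : {for (x_of z, u_of z), continuous g} by near: z.
have : closure [set z' | exists p, multipliers_at z' p] z.
  by apply: closureS zcl => z' /graph_F_multipliers.
move=> /(closure_bounded_snd (K := fun zp => multipliers_at zp.1 zp.2) (M := M))[].
  by near: z.
move=> p pcl; apply/graph_F_multipliers; exists p.
apply: (multipliers_at_closure (z := fst) (p := snd) pcl).
- exact: cvg_to_fst.
- exact: cvg_to_snd.
- exact: gz.
- by near=> t.
Unshelve. all: by end_near. Qed.

End NearReference.

End Multipliers.

(** * The upper estimate *)

Section Differential.
Variables (R : realType) (n d k : nat) (g : 'rV[R]_n * 'rV[R]_d -> 'rV[R]_k).
Implicit Types (x h : 'rV[R]_n) (u l : 'rV[R]_d) (y : 'rV[R]_k).

Lemma mul_grad_x x u h :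
  differentiable g (x, u) -> h *m grad_x g x u = 'd g (x, u) (h, 0).
Proof.
move=> dg; rewrite /grad_x -deriveEjacobian.
  rewrite -(deriveE (h, 0) dg) /derive.
  suff -> : (fun t : R => t^-1 *: (((fun x' => g (x', u)) \o shift x) (t *: h) - g (x, u))) =
      (fun t : R => t^-1 *: ((g \o shift (x, u)) (t *: (h, 0)) - g (x, u))) by [].
  by apply/funext => t /=; congr (_ *: (g (_, _) - _)); rewrite /= scaler0 add0r.
apply: (@differentiable_comp _ _ _ _ (fun x' => (x', u)) g) => //.
Qed.

Lemma mul_grad_u x u l :
  differentiable g (x, u) -> l *m grad_u g x u = 'd g (x, u) (0, l).
Proof.
move=> dg; rewrite /grad_u -deriveEjacobian.
  rewrite -(deriveE (0, l) dg) /derive.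
  suff -> : (fun t : R => t^-1 *: (((fun u' => g (x, u')) \o shift u) (t *: l) - g (x, u))) =
      (fun t : R => t^-1 *: ((g \o shift (x, u)) (t *: (0, l)) - g (x, u))) by [].
  by apply/funext => t /=; congr (_ *: (g (_, _) - _)); rewrite /= scaler0 add0r.
apply: (@differentiable_comp _ _ _ _ (fun u' => (x, u')) g) => //.
Qed.

Lemma dot_grad_x x u y h : differentiable g (x, u) ->
  dot (y *m (grad_x g x u)^T) h = dot y ('d g (x, u) (h, 0)).
Proof. by move=> dg; rewrite dot_mulmxl trmxK mul_grad_x. Qed.

Lemma dot_grad_u x u y l : differentiable g (x, u) ->
  dot (y *m (grad_u g x u)^T) l = dot y ('d g (x, u) (0, l)).
Proof. by move=> dg; rewrite dot_mulmxl trmxK mul_grad_u. Qed.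

Lemma diff_split x u h l :
  'd g (x, u) (h, l) = 'd g (x, u) (h, 0) + 'd g (x, u) (0, l).
Proof. by rewrite -linearD; congr ('d g _ (_, _)); rewrite ?addr0 ?add0r. Qed.

Lemma cvg_diff_quotient x u h l : differentiable g (x, u) ->
  (fun t : R => t^-1 *: (g (x + t *: h, u + t *: l) - g (x, u))) @ (0 : R)^'+ -->
    'd g (x, u) (h, l).
Proof.
move=> dg; have : derivable g (x, u) (h, l) by exact: diff_derivable.
rewrite -(deriveE (h, l) dg) => /cvg_dnbhs_at_right; apply: cvg_trans.
apply: near_eq_cvg; near=> t; congr (_ *: (g (_, _) - _)); exact: addrC.
Unshelve. all: by end_near. Qed.

Lemma differentiable_remainder (a : 'rV[R]_n * 'rV[R]_d) e :
  differentiable g a -> 0 < e ->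
  \forall z \near a, `|g z - g a - 'd g a (z - a)| <= e * `|z - a|.
Proof.
move=> /diff_locally/eqaddoP/(_ e) dg e0; have {}dg := dg e0.
rewrite [\forall z \near a, _](near_shift 0) subr0.
apply: filterS dg => t /=.
by rewrite addrK opprD addrA.
Qed.

End Differential.

Section UpperEstimate.
Variables (R : realType) (n m d : nat) (g : 'rV[R]_n * 'rV[R]_d -> 'rV[R]_n).
Local Notation point_type := ('rV[R]_(n + m * n + m + d + n)).
Local Notation Omega := (graph (unpacked (F (m := m) g))).
Local Notation triple := ((point_type * point_type) * 'rV[R]_m)%type.

(** Moving [x], [A], [u], the slack and the multiplier freely, and defining [b]
    and [w] from them, gives curves in the graph of [F]; regular normals are
    polar to their tangents. *)
Lemma regular_normal_curve x A b u w p xi al be mu y h H l s' p' :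
  differentiable g (x, u) ->
  multipliers_at g (gpoint x A b u w) p ->
  regular_normal Omega (gpoint x A b u w) (gpoint xi al be mu (- y)) ->
  (\forall t \near (0 : R)^'+,
     normal_cone orthant_nonpos (x *m A^T - b + t *: s') (p + t *: p')) ->
  dot xi h + dot (mxvec al) (mxvec H) + dot be (h *m A^T + x *m H^T - s') +
    dot mu l - dot y (p' *m A + p *m H - 'd g (x, u) (h, l)) <= 0.
Proof.
move=> dg [_]; rewrite !of_gpointE => pA reg Nt.
pose c t := gpoint (x + t *: h) (A + t *: H)
  ((x + t *: h) *m (A + t *: H)^T - (x *m A^T - b + t *: s')) (u + t *: l)
  ((p + t *: p') *m (A + t *: H) - g (x + t *: h, u + t *: l)).
have := regular_normal_tangent reg (c := c)
  (e := gpoint h H (h *m A^T + x *m H^T - s') l (p' *m A + p *m H - 'd g (x, u) (h, l))).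
rewrite dot_gpoint dotNl; apply.
  apply: filterS Nt => t Nt; apply/graph_F_multipliers; exists (p + t *: p').
  split; rewrite /c !of_gpointE; last by rewrite subrK.
  by rewrite opprB addrC subrK.
have idt : (fun t : R => t) @ (0 : R)^'+ --> (0 : R) by exact: cvg_at_right_filter.
have : (fun t => gpoint h H (h *m A^T + x *m H^T + t *: (h *m H^T) - s') l
    (p' *m A + p *m H + t *: (p' *m H) -
       t^-1 *: (g (x + t *: h, u + t *: l) - g (x, u)))) @ (0 : R)^'+ -->
    gpoint h H (h *m A^T + x *m H^T + 0 *: (h *m H^T) - s') l
      (p' *m A + p *m H + 0 *: (p' *m H) - 'd g (x, u) (h, l)).
  apply: cvg_gpoint; try exact: cvg_const.
    apply: cvg_subrmx; last exact: cvg_const.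
    by apply: cvg_addmx; [exact: cvg_const | apply: cvg_scalemx => //; exact: cvg_const].
  apply: cvg_subrmx; last exact: cvg_diff_quotient.
  by apply: cvg_addmx; [exact: cvg_const | apply: cvg_scalemx => //; exact: cvg_const].
rewrite !scale0r !addr0; apply: cvg_trans; apply: near_eq_cvg; near=> t.
have t0 : t != 0 by apply: lt0r_neq0; near: t; exact: nbhs_right_gt.
apply: (scalerI t0); rewrite [RHS]scalerA divff// scale1r /c sub_gpoint scale_gpoint.
have wE : w = p *m A - g (x, u) by rewrite pA addrK.
congr gpoint.
- by rewrite addrAC subrr add0r.
- by rewrite addrAC subrr add0r.
- have -> : (A + t *: H)^T = A^T + t *: H^T by apply/matrixP => i j; rewrite !mxE.
  rewrite !mulmxDl !mulmxDr -!scalemxAl -!scalemxAr.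
  rewrite !scalerDr scalerN; apply/rowP => i; rewrite !mxE; ring.
- by rewrite addrAC subrr add0r.
- rewrite wE !mulmxDl !mulmxDr -!scalemxAl -!scalemxAr.
  rewrite !scalerDr scalerN !scalerDr !scalerA divff// !scale1r.
  apply/rowP => i; rewrite !mxE; ring.
Unshelve. all: by end_near. Qed.

(** The curve inequality with a fixed pair of slack and multiplier is linear in
    the direction, hence an equality; the other directions test normality to the
    orthant graph. *)
Lemma regular_normal_graph_F x A b u w p xi al be mu y :
  differentiable g (x, u) ->
  multipliers_at g (gpoint x A b u w) p ->
  regular_normal Omega (gpoint x A b u w) (gpoint xi al be mu (- y)) ->
  (forall h H l, dot xi h + dot (mxvec al) (mxvec H) +
     dot be (h *m A^T + x *m H^T) + dot mu l - dot y (p *m H) +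
     dot y ('d g (x, u) (h, l)) = 0) /\
  compl_normal (x *m A^T - b) p (- be) (y *m A^T).
Proof.
move=> dg pz reg.
have Nsp : normal_cone orthant_nonpos (x *m A^T - b) p.
  by have [] := pz; rewrite !of_gpointE.
have ineq h H l : dot xi h + dot (mxvec al) (mxvec H) +
     dot be (h *m A^T + x *m H^T) + dot mu l - dot y (p *m H) +
     dot y ('d g (x, u) (h, l)) <= 0.
  have := regular_normal_curve (s' := 0) (p' := 0) h H l dg pz reg.
  rewrite subr0 mul0mx add0r dotBr opprB [dot y _ - _]addrC addrA; apply.
  by near=> t; rewrite !scaler0 !addr0.
split=> [h H l|].
  apply/eqP; rewrite eq_le ineq /= -oppr_le0.
  have := ineq (- h) (- H) (- l).
  have -> : ((- h, - l) : 'rV[R]_n * 'rV[R]_d) = - (h, l) by [].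
  rewrite !(linearN, mulNmx) -opprD !dotNr; apply: le_trans.
  by rewrite le_eqVlt; apply/orP; left; apply/eqP; ring.
apply: compl_normal_tangent => // s' p' Nt.
have := regular_normal_curve 0 0 0 dg pz reg Nt.
rewrite !linear0 mul0mx !dot0r !(add0r, addr0) dotNr -dotNl subr_le0.
by rewrite dot_mulmxl trmxK.
Unshelve. all: by end_near. Qed.


Lemma outer_rows (p q : 'rV[R]_m) (y x : 'rV[R]_n) :
  \matrix_(i < m) (p 0 i *: y + q 0 i *: x) = p^T *m y + q^T *m x.
Proof. by apply/matrixP => i j; rewrite !mxE !big_ord1 !mxE. Qed.

Lemma C1_around_cvg_diff (T : topologicalType) (f : T -> 'rV[R]_n * 'rV[R]_d) t
    (hl : 'rV[R]_n * 'rV[R]_d) :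
  C1_around g (f t) -> f @ t --> f t ->
  (fun t' => 'd g (f t') hl) @ t --> 'd g (f t) hl.
Proof.
move=> /nbhs_singleton[_ dc] ft; exact: cvg_comp ft (dc hl).
Qed.

(** Passage to the limit in [regular_normal_graph_F]: nearby normals come with
    multipliers, which stay bounded by positive linear independence. *)
Lemma coderivative_F_upper x (A : 'M[R]_(m, n)) b u w y :
  polyhedron A b x -> pos_lin_indep (active x A b) A -> C1_around g (x, u) ->
  coderivative (unpacked (F g)) (pack x A b u) w y `<=` coder_estimate g x A b u w y.
Proof.
move=> hx hPLI hg v nc; pose z0 := gpoint x A b u w; pose V := row_mx v (- y).
have cl : closure (regular_normals Omega) (z0, V) by exact: normal_cone_closure_regular.
have dg : differentiable g (x, u) by have [] := nbhs_singleton hg.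
have gc : {for (x, u), continuous g} by exact: differentiable_continuous.
have [M Mz] := near_multipliers_bounded w hx hPLI gc.
have dgz : \forall z \near z0, differentiable g (x_of z, u_of z).
  have xuz : (fun z => (x_of z, u_of z)) @ z0 --> (x_of z0, u_of z0) by exact: cvg_xu_of.
  rewrite !of_gpointE in xuz; apply: (xuz [set xu | differentiable g xu]).
  by apply: filterS hg => xu [].
pose K := [set t : triple |
  [/\ regular_normal Omega t.1.1 t.1.2, multipliers_at g t.1.1 t.2
    & differentiable g (x_of t.1.1, u_of t.1.1)]].
have Kb : \forall zV \near (z0, V), forall p, K (zV, p) -> `|p| <= M.
  have : \forall zV \near (z0, V), forall p, multipliers_at g zV.1 p -> `|p| <= M.
    have c1 : fst @ (z0, V) --> (z0, V).1 by exact: cvg_to_fst.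
    exact: c1 _ Mz.
  by apply: filterS => zV zVM p [_ /= /zVM].
have Kcl : closure [set zV | exists p, K (zV, p)] (z0, V).
  have dgzV : \forall zV \near (z0, V), differentiable g (x_of zV.1, u_of zV.1).
    have c1 : fst @ (z0, V) --> (z0, V).1 by exact: cvg_to_fst.
    exact: c1 _ dgz.
  apply: closureS (closure_near cl dgzV) => zV [zVr dgzV'].
  by have [/graph_F_multipliers[p zp] _] := zVr; exists p.
have [p pcl] := closure_bounded_snd Kb Kcl.
pose t0 := ((z0, V), p).
have z_t : (fun t : triple => t.1.1) @ t0 --> t0.1.1.
  by apply: cvg_to_fst; exact: cvg_to_fst.
have V_t : (fun t : triple => t.1.2) @ t0 --> t0.1.2.
  by apply: cvg_to_snd; exact: cvg_to_fst.
have p_t : (fun t : triple => t.2) @ t0 --> t0.2.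
  exact: cvg_to_snd.
have pz0 : multipliers_at g z0 p.
  apply: (multipliers_at_closure pcl z_t p_t); first by rewrite !of_gpointE.
  by near=> t => -[].
have Kreg t : K t ->
  (forall h H l, dot (x_of t.1.2) h + dot (mxvec (A_of t.1.2)) (mxvec H) +
     dot (b_of t.1.2) (h *m (A_of t.1.1)^T + x_of t.1.1 *m H^T) +
     dot (u_of t.1.2) l - dot (- w_of t.1.2) (t.2 *m H) +
     dot (- w_of t.1.2) ('d g (x_of t.1.1, u_of t.1.1) (h, l)) = 0) /\
  compl_normal (x_of t.1.1 *m (A_of t.1.1)^T - b_of t.1.1) t.2
    (- b_of t.1.2) (- w_of t.1.2 *m (A_of t.1.1)^T).
  move: t => [[z V'] q] [/= reg]; rewrite -{1}(gpointK z) => qz dgz'.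
  move: reg; rewrite -{1}(gpointK z) -{1}(gpointK V') -{1}[w_of V']opprK => reg.
  exact: regular_normal_graph_F dgz' qz reg.
have V_y : - w_of V = y by rewrite /w_of row_mxKr opprK.
have eqs h H l : dot (x_of V) h + dot (mxvec (A_of V)) (mxvec H) +
     dot (b_of V) (h *m A^T + x *m H^T) +
     dot (u_of V) l - dot y (p *m H) + dot y ('d g (x, u) (h, l)) = 0.
  pose f (t : triple) :=
     dot (x_of t.1.2) h + dot (mxvec (A_of t.1.2)) (mxvec H) +
     dot (b_of t.1.2) (h *m (A_of t.1.1)^T + x_of t.1.1 *m H^T) +
     dot (u_of t.1.2) l - dot (- w_of t.1.2) (t.2 *m H) +
     dot (- w_of t.1.2) ('d g (x_of t.1.1, u_of t.1.1) (h, l)).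
  have ft : f @ t0 --> f t0.
    apply: cvg_add; [apply: cvg_sub; [apply: cvg_add; [apply: cvg_add;
      [apply: cvg_add|]|]|]|].
    - by apply: cvg_dot; [exact: cvg_x_of | exact: cvg_const].
    - apply: cvg_dot; last exact: cvg_const.
      by apply: cvg_mxvec; exact: cvg_A_of.
    - apply: cvg_dot; first exact: cvg_b_of.
      apply: cvg_addmx; apply: cvg_mulmx; try exact: cvg_const.
        by apply: cvg_trmx; exact: cvg_A_of.
      exact: cvg_x_of.
    - by apply: cvg_dot; [exact: cvg_u_of | exact: cvg_const].
    - apply: cvg_dot; first by apply: cvg_oppmx; exact: cvg_w_of.
      by apply: cvg_mulmx => //; exact: cvg_const.
    - apply: cvg_dot; first by apply: cvg_oppmx; exact: cvg_w_of.
      apply: (C1_around_cvg_diff (f := fun t => (x_of t.1.1, u_of t.1.1))).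
        by rewrite !of_gpointE.
      exact: cvg_xu_of.
  have := closure_eq (g := fun=> 0) pcl ft.
  rewrite /f /t0 /= V_y !of_gpointE; apply; first exact: cvg_const.
  by near=> t => /Kreg[].
have cn : normal_orthant_coder x A b p y (- b_of V).
  apply/normal_cone_graph_orthant; split; first by have [] := pz0; rewrite !of_gpointE.
  pose f (t : triple) :=
    ((x_of t.1.1 *m (A_of t.1.1)^T - b_of t.1.1, t.2),
     (- b_of t.1.2, - w_of t.1.2 *m (A_of t.1.1)^T)).
  have -> : ((x *m A^T - b, p), (- b_of V, y *m A^T)) = f t0.
    by rewrite /f /t0 /= V_y !of_gpointE.
  apply: (closure_map pcl).
    apply: cvg_to_pair; apply: cvg_to_pair => //.
    - exact: cvg_slack.
    - by apply: cvg_oppmx; exact: cvg_b_of.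
    - apply: cvg_mulmx; first by apply: cvg_oppmx; exact: cvg_w_of.
      by apply: cvg_trmx; exact: cvg_A_of.
  near=> t => Kt; have [_ cnt] := Kreg t Kt; split=> //.
  by have [_ [Nt _] _] := Kt; exact: Nt.
exists p; first by move: pz0; rewrite /multipliers_at !of_gpointE.
exists (- b_of V) => //.
have vE : v = pack (x_of V) (A_of V) (b_of V) (u_of V).
  by rewrite -(row_mxKl v (- y)) -/V -{1}(gpointK V) row_mxKl.
rewrite [RHS]vE opprK; congr pack.
- apply: dot_inj => h; have := eqs h 0 0.
  rewrite dotBl dot_mulmxl dotNl dot_grad_x// !linear0 !dot0r.
  by rewrite !addr0; lra.
- apply: (can_inj mxvecK); apply: dot_inj => M'; rewrite -(vec_mxK M').
  have := eqs 0 (vec_mx M') 0.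
  rewrite outer_rows linearD /= dotDl !dot_mxvec_outer.
  rewrite (dotC y (p *m _)) dot_mulmxl linear0 mul0mx add0r !dot0r dotNl.
  by lra.
- apply: dot_inj => l; have := eqs 0 0 l.
  rewrite dotNl dot_grad_u// !linear0 mul0mx !dot0r.
  by rewrite !addr0 dot0r; lra.
Unshelve. all: by end_near. Qed.


End UpperEstimate.

(** * The lower estimate under linear independence *)

Section LowerEstimate.
Variables (R : realType) (n m d : nat) (g : 'rV[R]_n * 'rV[R]_d -> 'rV[R]_n).
Local Notation point_type := ('rV[R]_(n + m * n + m + d + n)).
Local Notation Omega := (graph (unpacked (F (m := m) g))).
Local Notation quadruple := (('rV[R]_m * 'rV[R]_m) * ('rV[R]_m * 'rV[R]_m))%type.

Definition dual_rows (I : {set 'I_m}) (A : 'M[R]_(m, n)) (B : 'M[R]_(n, m)) : Prop :=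
  forall i, i \in I -> row i A *m B = delta_mx 0 i.

Lemma free_dual_rows (I : {set 'I_m}) (A : 'M[R]_(m, n)) :
  free [seq row i A | i in I] -> exists B, dual_rows I A B.
Proof.
set X := [seq row i A | i in I] => Xfree.
have szX : size X = size (enum I) by rewrite size_map.
pose c i (v : 'rV[R]_n) : R :=
  if @insub _ _ 'I_(size X) (index i (enum I)) is Some k then coord (in_tuple X) k v else 0.
(* for [i] outside [I] the index overflows and the column is zero *)
exists (\matrix_(j, i) c i (delta_mx 0 j)) => i iI; apply/rowP => j.
have idx : (index i (enum I) < size X)%N by rewrite szX index_mem mem_enum.
have rowE : row i A = (in_tuple X)`_(Ordinal idx).
  by rewrite /= (nth_map i) ?index_mem ?mem_enum// nth_index ?mem_enum.
transitivity (c j (row i A)).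
  rewrite mxE [in RHS](row_sum_delta (row i A)).
  under eq_bigr do rewrite [X in _ * X]mxE.
  rewrite /c; case: insubP => [k _ _|_].
    by rewrite linear_sum; apply: eq_bigr => l _; rewrite linearZ.
  by rewrite big1// => l _; rewrite mulr0.
rewrite !mxE eqxx /c; case: insubP => [k jX kE|]; rewrite ?rowE.
  rewrite coord_free// -val_eqE/= kE eq_sym; congr (nat_of_bool _)%:R.
  apply/eqP/eqP => [ij|->//]; rewrite szX index_mem in jX.
  by rewrite -(nth_index i jX) ij nth_index// mem_enum.
rewrite szX index_mem mem_enum => jI; case: eqP => // ji.
by rewrite ji iI in jI.
Qed.

Lemma supported_dual_rows I A B (p : 'rV[R]_m) :
  dual_rows I A B -> supported I p -> p *m A *m B = p.
Proof.
move=> AB pI; rewrite -mulmxA mulmx_sum_row [RHS]row_sum_delta.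
apply: eq_bigr => i _; have [iI|/pI ->] := boolP (i \in I); last by rewrite !scale0r.
by rewrite row_mul AB.
Qed.

Lemma dual_rows_entry I A B (e : 'rV[R]_m) i :
  dual_rows I A B -> i \in I -> (e *m B^T *m A^T) 0 i = e 0 i.
Proof.
move=> AB iI; rewrite row_mul_tr dotC dot_mulmxl trmxK AB// .
exact: dot_deltar.
Qed.

Lemma ler_mul_div (C t e : R) : 0 <= C -> 0 <= t -> t <= e / (C + 1) -> C * t <= e.
Proof.
move=> C0 t0; rewrite ler_pdivlMr ?ltr_wpDl// => te.
by rewrite (le_trans _ te)// mulrDr mulr1 mulrC lerDl.
Qed.

(** With independent active rows a multiplier is a continuous function of the
    point, so that the regular normal inequality for the orthant graph lifts to
    the graph of [F], up to terms of second order. *)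
Lemma regular_normal_graph_F_lift x (A : 'M[R]_(m, n)) b u w (I : {set 'I_m}) B M p q h y :
  dual_rows I A B ->
  (\forall z \near gpoint x A b u w, forall p', multipliers_at g z p' ->
     supported I p' /\ `|p'| <= M) ->
  differentiable g (x, u) ->
  multipliers_at g (gpoint x A b u w) p ->
  compl_normal (x *m A^T - b) p q h ->
  (forall i, i \in I -> (y *m A^T) 0 i = h 0 i) ->
  regular_normal Omega (gpoint x A b u w)
    (gpoint (q *m A - y *m (grad_x g x u)^T) (p^T *m y + q^T *m x) (- q)
       (- (y *m (grad_u g x u)^T)) (- y)).
Proof.
move=> AB nearI dg pz cn yh; set z0 := gpoint x A b u w.
split=> [|e e0]; first by apply/graph_F_multipliers; exists p.
have [pI _] := nbhs_singleton nearI _ pz.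
have [Np pA] := pz; rewrite !of_gpointE in Np pA.
have M0 : 0 <= M by have [_] := nbhs_singleton nearI _ pz; apply: le_trans.
have [r r0 rP] := compl_normal_near Np cn.
pose e3 := e / 3.
have e30 : 0 < e3 by rewrite divr_gt0.
pose Cq : R := m%:R * `|q| * n%:R.
pose Cy : R := n%:R * `|y| * m%:R.
pose Cg : R := n%:R * `|y|.
have Cq0 : 0 <= Cq by rewrite !mulr_ge0.
have Cy0 : 0 <= Cy by rewrite !mulr_ge0.
have Cg0 : 0 <= Cg by rewrite !mulr_ge0.
have eq0 : 0 < e3 / (Cq + 1) by rewrite divr_gt0// ltr_wpDl.
have ey0 : 0 < e3 / (Cy + 1) by rewrite divr_gt0// ltr_wpDl.
have eg0 : 0 < e3 / (Cg + 1) by rewrite divr_gt0// ltr_wpDl.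
have gc : {for (x, u), continuous g} by exact: differentiable_continuous.
have xuz : (fun z => (x_of z, u_of z)) @ z0 --> (x_of z0, u_of z0) by exact: cvg_xu_of.
rewrite !of_gpointE in xuz.
have remz : \forall z \near z0, `|g (x_of z, u_of z) - g (x, u) -
    'd g (x, u) ((x_of z, u_of z) - (x, u))| <=
      e3 / (Cg + 1) * `|(x_of z, u_of z) - (x, u)|.
  exact: (xuz _ (differentiable_remainder dg eg0)).
have slackz : (fun z => `|x_of z *m (A_of z)^T - b_of z - (x *m A^T - b)|) @ z0 --> (0 : R).
  have -> : 0 = `|x_of z0 *m (A_of z0)^T - b_of z0 - (x *m A^T - b)|.
    by rewrite !of_gpointE subrr normr0.
  by apply: cvg_normmx; apply: cvg_subrmx; [exact: cvg_slack | exact: cvg_const].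
have dpz : (fun z => n%:R * (`|w_of z + g (x_of z, u_of z) - (w + g (x, u))| +
    m%:R * M * `|A_of z - A|) * `|B|) @ z0 --> (0 : R).
  have -> : 0 = n%:R * (`|w_of z0 + g (x, u) - (w + g (x, u))| +
    m%:R * M * `|A_of z0 - A|) * `|B|.
    by rewrite !of_gpointE !subrr !normr0 mulr0 addr0 mulr0 mul0r.
  apply: cvg_mul; last exact: cvg_const.
  apply: cvg_mul; first exact: cvg_const.
  apply: cvg_add.
    apply: cvg_normmx; apply: cvg_subrmx; last exact: cvg_const.
    by apply: cvg_addmx; [exact: cvg_w_of | exact: cvg_comp xuz gc].
  apply: cvg_mul; first exact: cvg_const.
  by apply: cvg_normmx; apply: cvg_subrmx; [exact: cvg_A_of | exact: cvg_const].
near=> z => /graph_F_multipliers[p' pz'].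
have [pI' pM] : supported I p' /\ `|p'| <= M by move: p' pz'; near: z.
have [Np' pA'] := pz'.
pose dx := x_of z - x; pose dA := A_of z - A; pose db := b_of z - b.
pose du := u_of z - u; pose dw := w_of z - w; pose dp := p' - p.
pose ds := x_of z *m (A_of z)^T - b_of z - (x *m A^T - b).
pose rem := g (x_of z, u_of z) - g (x, u) - 'd g (x, u) (dx, du).
have DE : z - z0 = gpoint dx dA db du dw by rewrite -{1}(gpointK z) sub_gpoint.
have dx_le : `|dx| <= `|z - z0| by rewrite DE norm_x_gpoint.
have dA_le : `|dA| <= `|z - z0| by rewrite DE norm_A_gpoint.
have du_le : `|du| <= `|z - z0| by rewrite DE norm_u_gpoint.
(* [dp] is recovered from [dp *m A], which is small because the graph equations
   express it through the variations of [w + g] and of [A] *)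
have dp_lt t : 0 < t -> n%:R * (`|w_of z + g (x_of z, u_of z) - (w + g (x, u))| +
    m%:R * M * `|A_of z - A|) * `|B| < t -> `|dp| < t.
  move=> t0; apply: le_lt_trans.
  have dpI : supported I dp by move=> i iI; rewrite !mxE pI'// pI// subrr.
  rewrite -{1}(supported_dual_rows AB dpI) (le_trans (norm_mulmx_le _ _))//.
  rewrite ler_wpM2r// ler_wpM2l//.
  have -> : dp *m A = w_of z + g (x_of z, u_of z) - (w + g (x, u)) - p' *m dA.
    by rewrite -pA -pA' mulmxBl mulmxBr; apply/rowP => i; rewrite !mxE; ring.
  rewrite (le_trans (ler_normB _ _))// lerD2l (le_trans (norm_mulmx_le _ _))//.
  by rewrite ler_wpM2r// ler_wpM2l.
have dpr : `|dp| < r by apply: dp_lt => //; near: z; exact: (cvgr_lt _ dpz).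
have dpe : `|dp| < e3 / (Cy + 1).
  by apply: dp_lt => //; near: z; exact: (cvgr_lt _ dpz).
have dsr : `|ds| < r by rewrite /ds; near: z; exact: (cvgr_lt _ slackz).
have De : `|z - z0| < e3 / (Cq + 1) by near: z; exact: near_norm_lt.
have rem_le : `|rem| <= e3 / (Cg + 1) * `|z - z0|.
  apply: (@le_trans _ _ (e3 / (Cg + 1) * `|(x_of z, u_of z) - (x, u)|)).
    by rewrite /rem /dx /du; near: z; exact: remz.
  by rewrite ler_pM2l// prod_normE/= ge_max dx_le du_le.
have qds : dot q ds <= dot h dp by exact: rP.
have hdp : dot h dp = dot y (dp *m A).
  rewrite (dotC y) dot_mulmxl dotC; apply: eq_bigr => i _.
  have [iI|iI] := boolP (i \in I); first by rewrite yh.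
  by rewrite !mxE pI'// pI// subrr !mul0r.
have t1 : `|dot q (dx *m dA^T)| <= e3 * `|z - z0|.
  rewrite (le_trans (norm_dot_le _ _))//.
  have := norm_mulmx_le dx dA^T; rewrite norm_trmx => h1.
  rewrite (le_trans (ler_wpM2l _ h1)) ?mulr_ge0//.
  rewrite !mulrA -/Cq ler_pM ?mulr_ge0//.
  by rewrite (ler_mul_div Cq0)// (le_trans dx_le)// ltW.
have t2 : `|dot y (dp *m dA)| <= e3 * `|z - z0|.
  rewrite (le_trans (norm_dot_le _ _))//.
  rewrite (le_trans (ler_wpM2l _ (norm_mulmx_le _ _))) ?mulr_ge0//.
  rewrite !mulrA -/Cy ler_pM ?mulr_ge0//.
  by rewrite (ler_mul_div Cy0)// ltW.
have t3 : `|dot y rem| <= e3 * `|z - z0|.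
  rewrite (le_trans (norm_dot_le _ _))// -/Cg (le_trans (ler_wpM2l _ rem_le))//.
  by rewrite mulrA ler_wpM2r// (ler_mul_div Cg0)// ltW.
(* all terms of first order but those of [q], [ds], [y] and [dp] cancel *)
have key : dot (gpoint (q *m A - y *m (grad_x g x u)^T) (p^T *m y + q^T *m x) (- q)
       (- (y *m (grad_u g x u)^T)) (- y)) (z - z0) =
    dot q ds - dot q (dx *m dA^T) - dot y (dp *m A) - dot y (dp *m dA) + dot y rem.
  rewrite DE dot_gpoint linearD /= !dotDl !dotNl dot_grad_x// dot_grad_u//.
  rewrite !dot_mxvec_outer dot_mulmxl.
  have -> : ds = dx *m A^T + x *m dA^T + dx *m dA^T - db.
    rewrite /ds /dx /dA /db.
    have -> : (A_of z - A)^T = (A_of z)^T - A^T by apply/matrixP => i j; rewrite !mxE.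
    rewrite !mulmxBl !mulmxBr.
    by apply/rowP => i; rewrite !mxE; ring.
  have -> : dw = dp *m A + p *m dA + dp *m dA - (g (x_of z, u_of z) - g (x, u)).
    have -> : dw = (w_of z + g (x_of z, u_of z)) - (w + g (x, u)) -
        (g (x_of z, u_of z) - g (x, u)) by apply/rowP => i; rewrite !mxE; ring.
    rewrite -pA -pA' /dp /dA !mulmxBl !mulmxBr.
    by apply/rowP => i; rewrite !mxE; ring.
  have -> : dot p (y *m dA^T) = dot y (p *m dA) by rewrite -dot_mulmxl dotC.
  rewrite /rem (diff_split g x u dx du) !(dotDr, dotBr, dotNr).
  by ring.
rewrite key; move: t1 t2 t3; rewrite !ler_norml => /andP[t1 _] /andP[t2 _] /andP[_ t3].
have e3E : e = e3 + e3 + e3 by rewrite /e3; field.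
by rewrite e3E !mulrDl; lra.
Unshelve. all: by end_near. Qed.


(** Normals of the orthant graph near the given one are lifted to the graph of F
    by a continuous map. *)
Lemma coder_estimate_lower x (A : 'M[R]_(m, n)) b u w y :
  polyhedron A b x -> pos_lin_indep (active x A b) A ->
  free [seq row i A | i in active x A b] -> C1_around g (x, u) ->
  coder_estimate g x A b u w y `<=` coderivative (unpacked (F g)) (pack x A b u) w y.
Proof.
move=> hx hPLI hfree hg _ [p pP [q /normal_cone_graph_orthant[Np cl] <-]].
have [B AB] := free_dual_rows hfree.
have dg : differentiable g (x, u) by have [] := nbhs_singleton hg.
have gc : {for (x, u), continuous g} by exact: differentiable_continuous.
have [M Mz] := near_multipliers_bounded w hx hPLI gc.
pose I := active x A b.
have near2 : \forall z1 \near gpoint x A b u w, \forall z \near z1,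
    forall p', multipliers_at g z p' -> supported I p' /\ `|p'| <= M.
  apply: near_join; near=> z => p' zp'.
  split; first by move: p' zp'; near: z; exact: near_supported.
  by move: p' zp'; near: z.
(* [y] is adjusted so that the second component of a nearby normal to the
   orthant graph is matched on the active rows *)
pose Y (h : 'rV[R]_m) := y + (h - y *m A^T) *m B^T.
have YI h i : i \in I -> (Y h *m A^T) 0 i = h 0 i.
  move=> iI; rewrite /Y mulmxDl mxE (dual_rows_entry _ AB iI).
  by move: (y *m A^T) => v; rewrite !mxE addrC subrK.
pose Z (t : quadruple) : point_type :=
  gpoint x A (x *m A^T - t.1.1) u (t.1.2 *m A - g (x, u)).
pose V (t : quadruple) : point_type :=
  gpoint (t.2.1 *m A - Y t.2.2 *m (grad_x g x u)^T)
    (t.1.2^T *m Y t.2.2 + t.2.1^T *m x) (- t.2.1)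
    (- (Y t.2.2 *m (grad_u g x u)^T)) (- Y t.2.2).
pose t0 := ((x *m A^T - b, p), (q, y *m A^T)).
have [_ pA] := pP.
have Z0 : Z t0 = gpoint x A b u w.
  by rewrite /Z /t0 /= opprB addrC subrK pA addrK.
have Y0 : Y (y *m A^T) = y by rewrite /Y subrr mul0mx addr0.
have t11 : (fun t : quadruple => t.1.1) @ t0 --> t0.1.1.
  by apply: cvg_to_fst; exact: cvg_to_fst.
have t12 : (fun t : quadruple => t.1.2) @ t0 --> t0.1.2.
  by apply: cvg_to_snd; exact: cvg_to_fst.
have t21 : (fun t : quadruple => t.2.1) @ t0 --> t0.2.1.
  by apply: cvg_to_fst; exact: cvg_to_snd.
have t22 : (fun t : quadruple => Y t.2.2) @ t0 -->
    Y t0.2.2.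
  apply: cvg_addmx; first exact: cvg_const.
  apply: cvg_mulmx; last exact: cvg_const.
  apply: cvg_subrmx; last exact: cvg_const.
  by apply: cvg_to_snd; exact: cvg_to_snd.
have Zt : Z @ t0 --> Z t0.
  apply: cvg_gpoint; try exact: cvg_const.
    by apply: cvg_subrmx => //; exact: cvg_const.
  apply: cvg_subrmx; last exact: cvg_const.
  by apply: cvg_mulmx => //; exact: cvg_const.
have Vt : V @ t0 --> V t0.
  apply: cvg_gpoint.
  - by apply: cvg_subrmx; apply: cvg_mulmx => //; exact: cvg_const.
  - apply: cvg_addmx; apply: cvg_mulmx => //; try exact: cvg_const; exact: cvg_trmx.
  - exact: cvg_oppmx.
  - by apply: cvg_oppmx; apply: cvg_mulmx => //; exact: cvg_const.
  - exact: cvg_oppmx.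
have -> : pack (q *m A - y *m (grad_x g x u)^T) (\matrix_i (p 0 i *: y + q 0 i *: x))
    (- q) (- (y *m (grad_u g x u)^T)) = lsubmx (V t0).
  by rewrite /V /t0 /gpoint row_mxKl /= Y0 outer_rows.
rewrite /coderivative /=.
have -> : row_mx (lsubmx (V t0)) (- y) = V t0.
  by rewrite -[RHS]hsubmxK; congr row_mx; rewrite /V /t0 /gpoint row_mxKr /= Y0.
rewrite -/(gpoint x A b u w) -Z0.
apply: closure_regular_normal_cone.
- rewrite Z0; apply: graph_F_locally_closed => //.
  by apply: filterS hg => z [dgz _]; exact: differentiable_continuous.
- by rewrite Z0; apply/graph_F_multipliers; exists p; rewrite /multipliers_at !of_gpointE.
rewrite -Z0 in near2.
apply: (closure_map (f := fun t => (Z t, V t)) cl); first exact: cvg_to_pair.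
have near2t : \forall t \near t0, \forall z \near Z t,
    forall p', multipliers_at g z p' -> supported I p' /\ `|p'| <= M.
  exact: (Zt _ near2).
near=> t => -[Nt cnt].
rewrite /regular_normals /= /Z /V.
apply: (regular_normal_graph_F_lift (I := I) (B := B) (M := M) (h := t.2.2)) => //.
- by near: t.
- by split; rewrite /= !of_gpointE ?subrK// opprB addrC subrK.
- by rewrite opprB addrC subrK.
- by move=> i; exact: YI.
Unshelve. all: by end_near. Qed.

Lemma multipliers_unique x (A : 'M[R]_(m, n)) b v p p' :
  free [seq row i A | i in active x A b] ->
  multipliers x A b v p -> multipliers x A b v p' -> p = p'.
Proof.
move=> /free_dual_rows[B AB].
have supp r : multipliers x A b v r -> supported (active x A b) r.
  move=> /multipliersE[rP _] i; rewrite inE => /negP ia; have [_ _ /eqP] := rP i.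
  by rewrite mulf_eq0 subr_eq0 => /orP[/ia|/eqP].
move=> pv p'v; rewrite -(supported_dual_rows AB (supp _ pv)).
rewrite -(supported_dual_rows AB (supp _ p'v)).
by have [_ ->] := pv; have [_ ->] := p'v.
Qed.

End LowerEstimate.

Theorem theorem6p2 (R : realType) (n m d : nat)
    (g : 'rV[R]_n * 'rV[R]_d -> 'rV[R]_n) (U : set 'rV[R]_d)
    (x : 'rV[R]_n) (A : 'M[R]_(m, n)) (b : 'rV[R]_m)
    (hx : polyhedron A b x)
    (hPLI : pos_lin_indep (active x A b) A)
    (w : 'rV[R]_n) (u : 'rV[R]_d) (hu : U u)
    (hg : C1_around g (x, u))
    (hw : G x A b (w + g (x, u))) :
  (forall y : 'rV[R]_n,
     (exists2 p, multipliers x A b (w + g (x, u)) p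
               & forall i, 0 < p 0 i -> dot (row i A) y = 0) ->
     coderivative (unpacked (F g)) (pack x A b u) w y
       `<=` coder_estimate g x A b u w y
     /\ (forall p q, multipliers x A b (w + g (x, u)) p ->
           normal_orthant_coder x A b p y q ->
           (forall i, dot (row i A) x < b 0 i \/
                      (p 0 i = 0 /\ dot (row i A) y < 0) -> q 0 i = 0) /\
           (forall i, dot (row i A) x = b 0 i -> p 0 i = 0 ->
                      0 < dot (row i A) y -> 0 <= q 0 i)))
  /\ (free [seq row i A | i in active x A b] ->
      (exists! p, multipliers x A b (w + g (x, u)) p) /\
      forall y : 'rV[R]_n,
        (exists2 p, multipliers x A b (w + g (x, u)) p
                  & forall i, 0 < p 0 i -> dot (row i A) y = 0) ->
        coderivative (unpacked (F g)) (pack x A b u) w y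
          = coder_estimate g x A b u w y).
Proof.
split=> [y _|hfree].
  split=> [|p q pP qP]; first exact: coderivative_F_upper.
  have sign i := normal_cone_graph_orthant_sign i qP.
  split=> [i|i _ _]; have [qs qneg qpos] := sign i; last by rewrite -row_mul_tr.
  case=> [xb|[_ yi]]; last by apply: qneg; rewrite row_mul_tr.
  by apply: qs; rewrite mxE row_mul_tr [(- b) _ _]mxE subr_lt0.
split=> [|y _].
  have [p pP] := (G_multipliers _ _ _ _).1 hw.
  by exists p; split=> // p' p'P; exact: multipliers_unique hfree pP p'P.
apply/seteqP; split; first exact: coderivative_F_upper.
exact: coder_estimate_lower.
Qed.
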